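(* Let $n\geq 3$ be an odd integer and let $a_{k1}$ ($1\le k\le n-1$) and $a_{k0}$ ($n+1\le k\le 2n-1$) be real numbers. Consider the system $$\dot x=-y+y\sum_{k=1}^{n-1}a_{k1}x^k+\sum_{k=n+1}^{2n-1}a_{k0}x^k,\qquad \dot y=x^{2n-1}.$$ If the origin is a (nilpotent) center of this system, then $a_{n+2,0}=-a_{11}a_{n+1,0}$.
   Context: The origin is a center if all orbits in some punctured neighborhood of it are periodic and surround it. Here $a_{n+1,0}$ and $a_{n+2,0}$ denote the coefficients $a_{k0}$ with $k=n+1$ and $k=n+2$, and $a_{11}$ is the coefficient $a_{k1}$ with $k=1$. *)

(* Defs.v *)
From HB Require Import structures.
From mathcomp Require Import all_boot all_order all_algebra.
From mathcomp Require Import all_classical all_reals all_analysis.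

Set Implicit Arguments.
Unset Strict Implicit.
Unset Printing Implicit Defensive.

Import Order.TTheory GRing.Theory Num.Theory.
Import numFieldNormedType.Exports.

Local Open Scope classical_set_scope.
Local Open Scope ring_scope.

Section PlanarSystems.
Variable R : realType.

Definition is_solution (P Q : R -> R -> R) (x y : R -> R) : Prop :=
  forall t : R, is_derive t 1 x (P (x t) (y t)) /\
                is_derive t 1 y (Q (x t) (y t)).

Definition orbit_of (x y : R -> R) : set (R * R) := range (fun t => (x t, y t)).

(* An equilibrium is not counted as a periodic orbit. *)
Definition is_periodic (x y : R -> R) : Prop :=
  (exists2 T : R, 0 < T & forall t, x (t + T) = x t /\ y (t + T) = y t) /\
  (exists t, (x t, y t) <> (x 0, y 0)).

(* The origin lies in a bounded component of the complement of G.  The first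
   conjunct matters: connected_component A p is empty when p is not in A. *)
Definition surrounds_origin (G : set (R * R)) : Prop :=
  ~ G (0, 0) /\ bounded_set (connected_component (~` G) (0, 0)).

(* "Orbits in a punctured neighborhood" are the orbits through its points; they
   may leave U.  Solutions are required on the whole line, which is no
   restriction for a periodic orbit.  For locally Lipschitz P and Q the solution
   (x, y) below is the only one through p, so it is the orbit of p. *)
Definition origin_is_center (P Q : R -> R -> R) : Prop :=
  exists2 U : set (R * R), nbhs (0, 0) U &
    forall p : R * R, U p -> p <> (0, 0) ->
      exists x y : R -> R,
        [/\ is_solution P Q x y, (x 0, y 0) = p, is_periodic x y &
            surrounds_origin (orbit_of x y)].

End PlanarSystems.

(* Main.v *)
(** Write the system as [x' = - y f(x) + B(x)], [y' = x^(2n-1)] with [f(0) = 1] and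
    [B = X^(n+1) b], so that [b_0 = a_(n+1,0)], [b_1 = a_(n+2,0)] and [f_1 = - a_11].  Let [xi] be
    the formal series with [xi = u + ...] and [xi' xi^(2n-1) = u^(2n-1) f(xi)].

    Analysis: taking [z = u^(2n) / (2n)] and [y] as coordinates, the right and left halves of an orbit
    solve [dz/dy = F(xi(u)) - y] and [dz/dy = F(xi(-u)) - y], where [F = B / f].  If [F(xi)] is not an
    even series, its first odd coefficient makes one of the right-hand sides larger than the other, and
    the two halves of an orbit starting at a crossing of the [y]-axis cannot close up.  Hence [F(xi)]
    is even: [F] takes the same value at [x = xi(u)] and at [s = xi(-u)].

    Algebra: the polynomials [P] in [t = 1/x] for which the vector field [P(t) d/dt] is invariant
    under [x -> s] include [t^(2n+1) f(1/t)], of degree [2n+1], and [t^(2n+1) B(1/t)], of degree [n]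
    if [b_0 <> 0].  Brackets of these two produce invariant fields of every large odd degree, so a
    dimension count gives a relation [P_0 + t P_1 + t^2 P_2 = 0] between them.  Therefore [s] is a
    rational function of [x], and counting degrees in the differential equation shows [s = c x] with
    [c <> 1], whence [f_1 = b_1 = 0].  If [b_0 = 0], evenness gives [b_1 = 0] directly. *)
Require Import Defs.
From HB Require Import structures.
From mathcomp Require Import all_boot all_order all_algebra.
From mathcomp Require Import all_classical all_reals all_analysis.
From mathcomp Require Import ring lra zify.

Set Implicit Arguments.
Unset Strict Implicit.
Unset Printing Implicit Defensive.

Import Order.TTheory GRing.Theory Num.Theory.
Import numFieldNormedType.Exports.

Local Open Scope classical_set_scope.
Local Open Scope ring_scope.

(** * Two points with the same values of an invariant quotient *)

(** Algebra: a bracket with the field of degree [2n + 1] or [n] raises degrees by [2n] or [n - 1].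
    As [n] is odd, these steps have greatest common divisor 2, so the invariant fields fill about
    half of the degrees. The multipliers 1, t, t^2 then yield about 3/2 times as many polynomials as
    the space has dimensions, which forces the relation. Invariance makes its coefficients at [x]
    and at [s] proportional, so [x] and [s] are the roots of one quadratic over the rational
    functions of [x]; one root being rational, so is the other.

    Analysis: the obstacle is that the slope of [z] is not a Lipschitz function of [z] at [z = 0],
    where the orbit crosses the [y]-axis. Monotonicity of the even part orders the two halves
    strictly, by comparison downward from the upper crossing; Gronwall's inequality upward from the
    lower crossing, where [z] grows at least linearly, excludes that order. Monotonicity and the
    sign of the odd coefficient are arranged by the symmetries (x, y) -> (-x, -y) and (t, y) -> (-t,
    -y). *)

Lemma poly_dependence (R : fieldType) (I : finType) (d : nat) (F : I -> {poly R}) :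
  (d < #|I|)%N -> (forall i, size (F i) <= d)%N ->
  exists2 c : I -> R, exists i, c i != 0 & \sum_i c i *: F i = 0.
Proof.
move=> ltdm szF; pose M := \matrix_(i < #|I|, j < d) (F (enum_val i))`_j.
have /rowV0Pn [v /sub_kermxP vM v0] : kermx M != 0.
  rewrite kermx_eq0 /row_free neq_ltn; apply/orP; left.
  exact: leq_ltn_trans (rank_leq_col _) ltdm.
exists (fun i => v ord0 (enum_rank i)).
  have [/existsP [i vi]|nv] := boolP [exists i, v ord0 i != 0].
    by exists (enum_val i); rewrite enum_valK.
  case/eqP: v0; apply/rowP => i; rewrite mxE.
  by move: nv; rewrite negb_exists => /forallP /(_ i) /negPn /eqP.
apply/polyP => j; rewrite coef0 coef_sum.
have [ltjd|ledj] := ltnP j d; last first.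
  rewrite big1 // => i _; rewrite coefZ nth_default ?mulr0 //.
  exact: leq_trans (szF i) ledj.
have /rowP /(_ (Ordinal ltjd)) := vM; rewrite !mxE => vMj; rewrite -[RHS]vMj.
rewrite (reindex_onto (@enum_val I predT) enum_rank) => [|i _]; last exact: enum_rankK.
rewrite (eq_bigl predT) => [|i]; last by rewrite /= enum_valK eqxx.
by apply: eq_bigr => i _; rewrite !mxE coefZ enum_valK.
Qed.

(** The summands start at the distinct exponents [2 * j], so the coefficients vanish one after the
    other from the lowest order on. *)
Lemma staggered_free (R : idomainType) (m : nat) (F : nat -> {poly R}) (a : nat -> R) :
  (forall j, (F j)`_0 != 0) -> \sum_(j < m) a j *: ('X^(2 * j) * F j) = 0 ->
  forall j, (j < m)%N -> a j = 0.
Proof.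
elim: m F a => [//|m IH] F a F0; rewrite big_ord_recl /= muln0 expr0 mul1r => sum0.
have a0 : a 0%N = 0.
  have := congr1 (fun p : {poly R} => p`_0) sum0; rewrite coefD coef_sum coefZ coef0.
  rewrite big1 ?addr0 => [/eqP|i _]; last first.
    by rewrite coefZ coefXnM mulr0.
  by rewrite mulf_eq0 (negPf (F0 0%N)) orbF => /eqP.
move: sum0; rewrite a0 scale0r add0r => sum0.
have {}sum0 : 'X^2 * \sum_(i < m) a i.+1 *: ('X^(2 * i) * F i.+1) = 0.
  rewrite -[RHS]sum0 mulr_sumr; apply: eq_bigr => i _.
  by rewrite -scalerAr mulrA -exprD /bump /= add1n mulnS.
move/eqP: sum0; rewrite mulf_eq0 expf_eq0 polyX_eq0 /= => /eqP sum0.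
case=> [//|j] ltjm.
by apply: (IH (fun j => F j.+1) (fun j => a j.+1)).
Qed.

(** In [t = 1/x], with coefficients reversed, this expression is the bracket of two vector fields,
    the degree of the first exceeding that of the second by [e]. *)
Lemma size_wronskian (R : idomainType) (p q : {poly R}) k l e :
  (size p <= k)%N -> (size q <= l.+1)%N ->
  (size ('X * (p^`() * q - p * q^`()) - (p * q) *+ e)%R <= k + l)%N.
Proof.
case: k => [|k] szp szq.
  by move: szp; rewrite leqn0 size_poly_eq0 => /eqP ->;
    rewrite deriv0 !mul0r subrr mulr0 mul0rn subrr size_poly0.
have szM (r t : {poly R}) a c : (size r <= a)%N -> (size t <= c)%N -> (size (r * t)%R <= (a + c).-1)%N.
  move=> ra tc; apply: leq_trans (size_polyMleq _ _) _.
  by have := leq_add ra tc; case: (size r + size t)%N; case: (a + c)%N.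
have szd (r : {poly R}) a : (size r <= a.+1)%N -> (size r^`() <= a)%N.
  by move=> ra; apply: leq_trans (size_poly _ _) _; case: (size r) ra.
apply: leq_trans (size_polyD _ _) _; rewrite size_polyN geq_max; apply/andP; split; last first.
  rewrite -mulr_natr; apply: leq_trans (szM _ _ (k + l).+1 1%N _ _) _.
  - by apply: leq_trans (szM _ _ _ _ szp szq) _; lia.
  - by rewrite -polyC_natr size_polyC leq_b1.
  - by lia.
apply: leq_trans (szM _ _ 2%N (k + l)%N _ _) _; rewrite ?size_polyX //.
apply: leq_trans (size_polyD _ _) _; rewrite size_polyN geq_max; apply/andP; split.
  by apply: leq_trans (szM _ _ _ _ (szd _ _ szp) szq) _; lia.
by apply: leq_trans (szM _ _ _ _ szp (szd _ _ szq)) _; lia.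
Qed.

Lemma coef_comp_scaleX (R : comNzRingType) (p : {poly R}) c i :
  (p \Po (c *: 'X))`_i = c ^+ i * p`_i.
Proof.
rewrite comp_polyE coef_sum; have [lti|lei] := ltnP i (size p).
  rewrite (bigD1 (Ordinal lti)) //= big1 => [|j].
    by rewrite addr0 coefZ exprZn coefZ coefXn eqxx mulr1 mulrC.
  by rewrite -val_eqE /= eq_sym coefZ exprZn coefZ coefXn => /negPf ->; rewrite !mulr0.
rewrite [in RHS]nth_default // mulr0 big1 // => j _.
rewrite coefZ exprZn coefZ coefXn; case: eqP => [ij|_]; last by rewrite !mulr0.
by move: (ltn_ord j); rewrite -ij ltnNge lei.
Qed.

Section Evaluation.
Variables (R D : comNzRingType) (iota : {rmorphism R -> D}).

Definition evp (p : {poly R}) (a : D) : D := (map_poly iota p).[a].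

Lemma evpD p q a : evp (p + q) a = evp p a + evp q a.
Proof. by rewrite /evp rmorphD hornerD. Qed.
Lemma evpB p q a : evp (p - q) a = evp p a - evp q a.
Proof. by rewrite /evp rmorphB hornerD hornerN. Qed.
Lemma evpN p a : evp (- p) a = - evp p a.
Proof. by rewrite /evp rmorphN hornerN. Qed.
Lemma evpM p q a : evp (p * q) a = evp p a * evp q a.
Proof. by rewrite /evp rmorphM hornerM. Qed.
Lemma evpXn p k a : evp (p ^+ k) a = evp p a ^+ k.
Proof. by rewrite /evp rmorphXn horner_exp. Qed.
Lemma evpX a : evp 'X a = a.
Proof. by rewrite /evp map_polyX hornerX. Qed.
Lemma evpC c a : evp c%:P a = iota c.
Proof. by rewrite /evp map_polyC hornerC. Qed.
Lemma evpZ c p a : evp (c *: p) a = iota c * evp p a.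
Proof. by rewrite -mul_polyC evpM evpC. Qed.
Lemma evpMn p k a : evp (p *+ k) a = evp p a *+ k.
Proof. by rewrite /evp rmorphMn hornerMn. Qed.
Lemma evp0 a : evp 0 a = 0.
Proof. by rewrite /evp rmorph0 horner0. Qed.
Lemma evp_sum (I : Type) (r : seq I) (F : I -> {poly R}) a :
  evp (\sum_(i <- r) F i) a = \sum_(i <- r) evp (F i) a.
Proof. by rewrite /evp rmorph_sum horner_sum. Qed.
Definition evpE := (evp0, evpX, evpC, evpXn, evpB, evpD, evpN, evpM, evpZ, evpMn).

Lemma evp_comp p q a : evp (p \Po q) a = evp p (evp q a).
Proof. by rewrite /evp map_comp_poly horner_comp. Qed.

End Evaluation.

(** * Invariant vector fields over a differential domain *)

Section Invariants.
Variables (R : numFieldType) (D : comNzRingType) (iota : {rmorphism R -> D}).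
Variable der : D -> D.
Hypothesis D_dom : forall a b : D, a * b = 0 -> a = 0 \/ b = 0.
Hypothesis derD : forall a b, der (a + b) = der a + der b.
Hypothesis derM : forall a b, der (a * b) = der a * b + a * der b.
Hypothesis derC : forall c, der (iota c) = 0.

Local Notation evp := (evp iota).

Lemma der_evp p a : der (evp p a) = evp p^`() a * der a.
Proof.
elim/poly_ind: p => [|p c IH]; first by rewrite deriv0 !evpE -(rmorph0 iota) derC rmorph0 mul0r.
by rewrite derivMXaddC !evpE derD derM derC IH; ring.
Qed.

Lemma der_exp (a : D) k : der (a ^+ k) * a = a ^+ k * der a *+ k.
Proof.
have -> : a ^+ k = evp 'X^k a by rewrite !evpE.
rewrite der_evp derivXn !evpE; case: k => [|k]; first by rewrite !mulr0n !mul0r.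
by rewrite /= exprS; ring.
Qed.

Lemma D_cancel (a b c : D) : a != 0 -> a * b = a * c -> b = c.
Proof.
move=> a0 /eqP; rewrite -subr_eq0 -mulrBr => /eqP /D_dom[] /eqP.
  by rewrite (negPf a0).
by rewrite subr_eq0 => /eqP.
Qed.

Lemma D_mul_neq0 (a b : D) : a != 0 -> b != 0 -> a * b != 0.
Proof. by move=> a0 b0; apply/eqP => /D_dom[] /eqP; exact/negP. Qed.

Lemma D_exp_neq0 (a : D) k : a != 0 -> a ^+ k != 0.
Proof.
move=> a0; elim: k => [|k IH]; first by rewrite expr0 oner_eq0.
by rewrite exprS D_mul_neq0.
Qed.

(** An element with nonzero derivative is transcendental over the constants: differentiating an
    algebraic relation gives one of lower degree, and in characteristic 0 a polynomial with zero
    derivative is constant. *)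
Lemma evp_inj p a : der a != 0 -> evp p a = 0 -> p = 0.
Proof.
move=> da; have [m] := ubnP (size p); elim: m p => // m IH p szp pa0.
have [szp1|szp1] := leqP (size p) 1.
  move: pa0; rewrite (size1_polyC szp1) !evpE => /eqP.
  by rewrite fmorph_eq0 => /eqP ->.
have dp0 : p^`() = 0.
  apply: IH.
    have p0 : p != 0 by rewrite -size_poly_gt0 ltnW.
    exact: leq_trans (lt_size_deriv p0) szp.
  have : der a * evp p^`() a = der a * 0.
    by rewrite mulrC -der_evp pa0 mulr0 -[in LHS](rmorph0 iota) derC.
  exact: D_cancel.
suff : (size p <= 1)%N by rewrite leqNgt szp1.
apply/leq_sizeP => j j1.
have := congr1 (fun p : {poly R} => p`_j.-1) dp0.
by case: j j1 => // j _; rewrite coef_deriv coef0 /= => /eqP; rewrite mulrn_eq0 /= => /eqP.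
Qed.

Variables (n : nat) (f b : {poly R}) (x s v : D).
Hypotheses (n3 : (3 <= n)%N) (nodd : odd n) (f0 : f`_0 = 1) (szf : (size f <= n)%N)
  (b0 : b`_0 != 0) (szb : (size b <= n.-1)%N).
Hypotheses (v_neq0 : v != 0) (dx_neq0 : der x != 0) (ds_neq0 : der s != 0) (s_neq_x : s != x).
Hypothesis x_ode : der x * x ^+ (2 * n - 1) = v * evp f x.
Hypothesis s_ode : der s * s ^+ (2 * n - 1) = v * evp f s.
Hypothesis B_inv : evp b x * x ^+ n.+1 * evp f s = evp b s * s ^+ n.+1 * evp f x.

(* The rational function [P(X) / (X^e f(X))] takes the same value at [x] and [s]. *)
Definition invariant (P : {poly R}) (e : nat) : Prop :=
  evp P x * evp f s * s ^+ e = evp P s * evp f x * x ^+ e.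

Let nz p a : der a != 0 -> p != 0 -> evp p a != 0.
Proof. by move=> da p0; apply/eqP => /(evp_inj da) /eqP; exact/negP. Qed.

Let f_neq0 : f != 0.
Proof. by apply/eqP => f00; move/eqP: f0; rewrite f00 coef0 eq_sym oner_eq0. Qed.
Let b_neq0 : b != 0.
Proof. by apply/eqP => b00; move: b0; rewrite b00 coef0 eqxx. Qed.
Let X_neq0 : 'X != 0 :> {poly R}.
Proof. by rewrite polyX_eq0. Qed.
Let x_neq0 : x != 0.
Proof. by rewrite -[x](evpX iota) nz. Qed.
Let s_neq0 : s != 0.
Proof. by rewrite -[s](evpX iota) nz. Qed.

Let ode2 (a : D) : der a * a ^+ (2 * n - 1) = v * evp f a ->
  der a * a ^+ (2 * n) = v * evp f a * a.
Proof.
by move=> <-; rewrite -mulrA -exprSr; congr (_ * _ ^+ _); move: n3; clear; lia.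
Qed.

(** On functions of [x] and of [s] alike, [v^-1 der] acts as the derivation [X^(1-2n) f d/dX].
    Applied to the invariant [P / (X^e f)], it gives the new one, which corresponds to the bracket
    with the field of [f]. *)
Lemma invariant_ode P e : invariant P e ->
  invariant ('X * (P^`() * f - P * f^`()) - (P * f) *+ e) (e + 2 * n).
Proof.
rewrite /invariant => inv.
have xo := ode2 x_ode; have so := ode2 s_ode.
have dinv := congr1 der inv; rewrite !derM !der_evp in dinv.
have xe := der_exp x e; have se := der_exp s e.
move: inv dinv xe se xo so; rewrite !evpE !(exprD _ e (2 * n)).
move: (der (x ^+ e)) (der (s ^+ e)) => dxe dse.
move: (x ^+ e) (s ^+ e) (x ^+ (2 * n)) (s ^+ (2 * n)) => xE sE xN sN.
move: (evp P x) (evp P s) (evp f x) (evp f s) (evp P^`() x) (evp P^`() s)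
  (evp f^`() x) (evp f^`() s) (der x) (der s) => Px Ps fx fs dPx dPs dfx dfs dx ds.
move=> inv dinv xe se xo so.
apply: (D_cancel v_neq0); apply: (D_cancel x_neq0); apply: (D_cancel s_neq0).
apply/eqP; rewrite -subr_eq0; apply/eqP.
(* With denominators cleared, the goal is a combination of the differentiated relation, the two
   equations, the rules for powers and the invariance of [P]. *)
have -> : 0 = x * s * xN * sN * (((dPx * dx * fs + Px * (dfs * ds)) * sE + Px * fs * dse)
    - ((dPs * ds * fx + Ps * (dfx * dx)) * xE + Ps * fx * dxe))
  - (dx * xN - v * fx * x) * (x * s * sN * (dPx * fs * sE - Ps * dfx * xE))
  - (ds * sN - v * fs * s) * (x * s * xN * (Px * dfs * sE - dPs * fx * xE))
  - (dse * s - sE * ds *+ e) * (x * xN * sN * Px * fs)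
  + (dxe * x - xE * dx *+ e) * (s * xN * sN * Ps * fx)
  - (ds * sN - v * fs * s) * (x * xN * Px * fs * sE *+ e)
  + (dx * xN - v * fx * x) * (s * sN * Ps * fx * xE *+ e)
  - (Px * fs * sE - Ps * fx * xE) *
      (v * x * s * (x * sN * dfx + s * xN * dfs + (fx * sN + fs * xN) *+ e)).
  by rewrite dinv xo so xe se inv !subrr !mul0r !mulr0; ring.
ring.
Qed.

(* Compares the quotient of [P / (X^e f)] by [B / f], which is [P / (X^(e+n+1) b)]. *)
Lemma invariant_bracket P e : invariant P e ->
  invariant ('X * (P^`() * b - P * b^`()) - (P * b) *+ (e + n.+1)) (e + n.-1).
Proof.
rewrite /invariant => inv; set E := (e + n.+1)%N.
have quo : evp P x * evp b s * s ^+ E = evp P s * evp b x * x ^+ E.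
  apply: (D_cancel (D_mul_neq0 (nz dx_neq0 f_neq0) (nz ds_neq0 f_neq0))).
  rewrite !exprD; apply/eqP; rewrite -subr_eq0; apply/eqP.
  move: inv B_inv.
  move: (x ^+ e) (s ^+ e) (x ^+ n.+1) (s ^+ n.+1) => xE sE xN sN inv Binv.
  have -> : 0 = evp b s * sN * evp f x * (evp P x * evp f s * sE - evp P s * evp f x * xE)
      - evp P s * evp f x * xE * (evp b x * xN * evp f s - evp b s * sN * evp f x).
    by rewrite inv Binv !subrr; ring.
  ring.
have xo := ode2 x_ode; have so := ode2 s_ode.
have dinv := congr1 der quo; rewrite !derM !der_evp in dinv.
have xe := der_exp x E; have se := der_exp s E.
(* The same derivation applied to [P / (X^E b)]: with [W] the polynomial of the goal,
   [W f / (X^(E+2n) b^2)] is invariant. *)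
have key : (evp 'X s * (evp P^`() s * evp b s - evp P s * evp b^`() s) - evp P s * evp b s *+ E)
     * evp f s * evp b x ^+ 2 * x ^+ E * x ^+ (2 * n)
   = (evp 'X x * (evp P^`() x * evp b x - evp P x * evp b^`() x) - evp P x * evp b x *+ E)
     * evp f x * evp b s ^+ 2 * s ^+ E * s ^+ (2 * n).
  move: quo dinv xe se xo so; rewrite !evpX.
  move: (der (x ^+ E)) (der (s ^+ E)) => dxe dse.
  move: (x ^+ E) (s ^+ E) (x ^+ (2 * n)) (s ^+ (2 * n)) => xE sE xN sN.
  move: (evp P x) (evp P s) (evp b x) (evp b s) (evp P^`() x) (evp P^`() s)
    (evp b^`() x) (evp b^`() s) (der x) (der s) (evp f x) (evp f s)
    => Px Ps fx fs dPx dPs dfx dfs dx ds gx gs.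
  move=> quo dinv xe se xo so.
  apply: (D_cancel v_neq0); apply: (D_cancel x_neq0); apply: (D_cancel s_neq0).
  apply/eqP; rewrite -subr_eq0; apply/eqP.
  have -> : 0 = fx * fs * (
    x * s * xN * sN * (((dPs * ds * fx + Ps * (dfx * dx)) * xE + Ps * fx * dxe)
      - ((dPx * dx * fs + Px * (dfs * ds)) * sE + Px * fs * dse))
    + (dx * xN - v * gx * x) * (x * s * sN * (dPx * fs * sE - Ps * dfx * xE))
    + (ds * sN - v * gs * s) * (x * s * xN * (Px * dfs * sE - dPs * fx * xE))
    + (dse * s - sE * ds *+ E) * (x * xN * sN * Px * fs)
    - (dxe * x - xE * dx *+ E) * (s * xN * sN * Ps * fx)
    + (ds * sN - v * gs * s) * (x * xN * Px * fs * sE *+ E)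
    - (dx * xN - v * gx * x) * (s * sN * Ps * fx * xE *+ E))
    + (Px * fs * sE - Ps * fx * xE) * v * x * s *
      (x * dfx * fs * gx * sN + fs * gx * fx * sN *+ E + s * dfs * fx * gs * xN + fx * gs * fs * xN *+ E).
    by rewrite dinv xo so xe se quo !subrr !mul0r !mulr0; ring.
  ring.
(* Multiplication by the square of the invariant [X^(n+1) b / f] leaves [W / (X^(E-2) f)], and
   [E - 2 = e + n - 1]. *)
move: key B_inv; rewrite !evpE.
have eE (a : D) : a ^+ E = a ^+ (e + n.-1) * a ^+ 2 by rewrite -exprD; congr (_ ^+ _); rewrite /E; move: n3; clear; lia.
have e2n (a : D) : a ^+ (2 * n) = (a ^+ n) ^+ 2 by rewrite mulnC exprM.
rewrite !eE !e2n !(exprSr _ n).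
have : evp f x * evp b s ^+ 2 * s ^+ 2 * (s ^+ n) ^+ 2 != 0.
  by rewrite !D_mul_neq0 ?D_exp_neq0 ?nz.
move: (x ^+ (e + n.-1)) (s ^+ (e + n.-1)) (x ^+ n) (s ^+ n) => x1 s1 xn sn nz0 key Binv.
apply: (D_cancel nz0).
set Ps := (X in _ = _ * (X * _ * x1)) in key *.
set Px := (X in _ * (X * _ * s1)) in key *.
apply/eqP; rewrite -subr_eq0; apply/eqP.
have -> : 0 = evp f s * (Px * evp f x * evp b s ^+ 2 * (s1 * s ^+ 2) * sn ^+ 2 -
    Ps * evp f s * evp b x ^+ 2 * (x1 * x ^+ 2) * xn ^+ 2)
   + Ps * x1 * (evp b x * (xn * x) * evp f s - evp b s * (sn * s) * evp f x) *
      (evp b x * (xn * x) * evp f s + evp b s * (sn * s) * evp f x).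
  by rewrite key Binv !subrr; ring.
ring.
Qed.

Lemma invariant_shift P e k : invariant P e -> invariant ('X^k * P) (e + k).
Proof.
rewrite /invariant !evpE !exprD => inv; apply/eqP; rewrite -subr_eq0; apply/eqP.
have -> : 0 = x ^+ k * s ^+ k * (evp P x * evp f s * s ^+ e - evp P s * evp f x * x ^+ e).
  by rewrite inv subrr mulr0.
ring.
Qed.

Lemma invariant_lin (I : Type) (r : seq I) (c : I -> R) (P : I -> {poly R}) e :
  (forall i, invariant (P i) e) -> invariant (\sum_(i <- r) c i *: P i) e.
Proof.
move=> inv; rewrite /invariant !evp_sum !mulr_suml; apply: eq_bigr => i _.
by rewrite !evpZ -!mulrA; congr (_ * _); rewrite !mulrA inv.
Qed.

(* [P] stands for [t^(e+2n+1) P(1/t)], a polynomial in [t = 1/x] of degree exactly [e + 2n + 1]. *)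
Definition full_degree_invariant (P : {poly R}) (e : nat) : Prop :=
  [/\ P`_0 != 0, (size P <= e + 2 * n + 2)%N & invariant P e].

(** The new constant coefficient is [- e P_0], whence [0 < e]: the field of [f] commutes with
    itself. *)
Lemma full_degree_ode P e : (0 < e)%N -> full_degree_invariant P e ->
  exists P', full_degree_invariant P' (e + 2 * n).
Proof.
move=> e0 [P0 szP /invariant_ode inv]; eexists; split; last exact: inv.
  rewrite coefB coefXM coefMn coef0M f0 mulr1 sub0r oppr_eq0 mulrn_eq0.
  by rewrite (negPf P0) orbF -lt0n.
have szf' : (size f <= n.-1.+1)%N by rewrite prednK // (leq_trans _ n3).
by apply: leq_trans (size_wronskian e szP szf') _; move: n3; clear; lia.
Qed.

Lemma full_degree_bracket P e : full_degree_invariant P e ->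
  exists P', full_degree_invariant P' (e + n.-1).
Proof.
move=> [P0 szP /invariant_bracket inv]; eexists; split; last exact: inv.
  rewrite coefB coefXM coefMn coef0M sub0r oppr_eq0 mulrn_eq0.
  by rewrite mulf_eq0 (negPf P0) (negPf b0) addnS.
have szb' : (size b <= n.-1.+1)%N by exact: leqW.
by apply: leq_trans (size_wronskian _ szP szb') _; move: n3; clear; lia.
Qed.

(** With [n = 2h + 1], the brackets add [2h] or [2n = 4h + 2] to [e]. If [i = q h + r] with [r < h],
    then [2i = 2h (q - 2r) + 2n r], and [i >= n^2] makes [q - 2r] positive. *)
Lemma exists_full_degree i : (n * n <= i)%N -> exists P, full_degree_invariant P (2 * i).
Proof.
move=> lei; have [h nE] : exists h, n = (2 * h).+1 by exists n./2; move: nodd; clear; lia.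
have gen j k : exists P, full_degree_invariant P (n.-1 * k.+1 + 2 * n * j).
  elim: k => [|k [P goodPk]].
    elim: j => [|j [P goodPj]].
      (* At exponent 0 the bracket with [f] degenerates, so the first bracket is taken with [b]. *)
      have : full_degree_invariant f 0.
        by split; rewrite ?f0 ?oner_eq0 //; [move: szf; clear; lia|rewrite /invariant !expr0 !mulr1 mulrC].
      by move/full_degree_bracket => [P goodPn]; exists P; rewrite muln1 muln0 addn0 -[n.-1]add0n.
    have [|P' invP'] := full_degree_ode _ goodPj; first by move: n3; clear; lia.
    by exists P'; rewrite (mulnS (2 * n)) [(2 * n + _)%N]addnC addnA.
  have [P' invP'] := full_degree_bracket goodPk.
  by exists P'; rewrite (mulnS _ k.+1) -addnA addnC.
have h0 : (0 < h)%N by move: n3 nE; clear; lia.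
have q_large : (2 * h < i %/ h)%N.
  by rewrite leq_divRL //; apply: leq_trans lei; rewrite nE; clear; nia.
suff -> : (2 * i = n.-1 * (i %/ h - 2 * (i %% h) - 1).+1 + 2 * n * (i %% h))%N by exact: gen.
have r_small := ltn_pmod i h0; rewrite [in LHS](divn_eq i h) nE /=; move: (i %/ h)%N (i %% h)%N q_large r_small => q r qh rh.
move: qh rh; clear => qh rh.
have -> : (q - 2 * r - 1).+1 = (q - 2 * r)%N by lia.
have -> : q = (q - 2 * r + 2 * r)%N by lia.
rewrite addnK; move: (q - 2 * r)%N => d. nia.
Qed.

Lemma rational_conj : exists P Q, [/\ coprimep P Q, Q != 0 & s * evp Q x = evp P x].
Proof.
(* [M] is the least value for which the [3 * M] polynomials outnumber the dimension [E + 2 * n + 4 =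
   2 * M + 2 * i0 + 2 * n + 2]. *)
pose i0 := (n * n)%N; pose M := (2 * i0 + 2 * n + 3)%N; pose E := (2 * (i0 + M.-1))%N.
have [G goodG] := choice (fun i => exists_full_degree (leq_addr i i0)).
(* [F j] has exponent [E - 2 * j]; the factor ['X^(2 * j)] brings it to the common exponent [E] and
   leaves the polynomial in [t] unchanged. *)
pose F j := G (M.-1 - j)%N; pose Q (j : 'I_M) := 'X^(2 * j) * F j.
have Qinv j : invariant (Q j) E.
  have [_ _ /invariant_shift -/(_ (2 * j)%N)] := goodG (M.-1 - j)%N.
  by congr (invariant _ _); have := ltn_ord j; rewrite /E; clear; lia.
have szQ j : (size (Q j) <= E + 2 * n + 2)%N.
  have [_ szG _] := goodG (M.-1 - j)%N.
  apply: leq_trans (size_polyMleq _ _) _; rewrite size_polyXn.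
  by have := ltn_ord j; move: szG; rewrite /E /F; clear; lia.
pose T (aj : 'I_3 * 'I_M) := 'X^(aj.1) * Q aj.2.
have [||c [[a j] caj] sum0] := @poly_dependence R _ (E + 2 * n + 4) T.
- by rewrite card_prod !card_ord /E /M; clear; lia.
- case=> a j; rewrite /T [_.1]/= [_.2]/=; apply: leq_trans (size_polyMleq _ _) _.
  rewrite size_polyXn; have := szQ j; have := ltn_ord a; clear.
  by move: (size (Q j)) (nat_of_ord a) => z k; lia.
pose Pa a := \sum_j c (a, j) *: Q j.
have Pinv a' : invariant (Pa a') E by exact: invariant_lin.
have Pa_neq0 : Pa a != 0.
  apply/eqP => Pa0; move/eqP: caj; apply.
  pose d k := if insub k is Some j then c (a, j) else 0.
  have dE (i : 'I_M) : d i = c (a, i) by rewrite /d valK.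
  rewrite -dE; apply: (@staggered_free R M F d) => // [k|]; first by have [] := goodG (M.-1 - k)%N.
  by rewrite -[RHS]Pa0; apply: eq_bigr => i _; rewrite dE.
have rel : Pa 0 + 'X * Pa 1 + 'X^2 * Pa 2%:R = 0.
  have {}sum0 : \sum_a \sum_j c (a, j) *: T (a, j) = 0.
    by rewrite pair_bigA -[RHS]sum0; apply: eq_bigr; case.
  rewrite -[RHS]sum0.
  have E1 a' : \sum_(j0 < M) c (a', j0) *: T (a', j0) = 'X^a' * Pa a'.
    by rewrite mulr_sumr; apply: eq_bigr => i _; rewrite /T -scalerAr.
  rewrite !big_ord_recl big_ord0 !E1 addr0 /= expr0 mul1r addrA.
  have -> : lift ord0 (ord0 : 'I_2) = 1 :> 'I_3 by exact: val_inj.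
  by have -> : lift ord0 (lift ord0 (ord0 : 'I_1)) = 2%:R :> 'I_3 by exact: val_inj.
have relx := congr1 (evp^~ x) rel; have rels := congr1 (evp^~ s) rel.
rewrite /= !evpE in relx rels.
(* All three [Pa] pass from [s] to [x] with the same factor, so the relation at [s] keeps its powers
   of [s] but takes its coefficients at [x]. *)
have rels' : evp (Pa 0) x + s * evp (Pa 1) x + s ^+ 2 * evp (Pa 2%:R) x = 0.
  have nz0 : evp f s * s ^+ E != 0 by rewrite D_mul_neq0 ?D_exp_neq0 ?nz.
  apply: (D_cancel nz0); rewrite mulr0 -[RHS](mulr0 (evp f x * x ^+ E)) -rels.
  have P0 := Pinv 0; have P1 := Pinv 1; have P2 := Pinv 2%:R.
  rewrite /invariant in P0 P1 P2.
  move: P0 P1 P2; move: (s ^+ E) (x ^+ E) => sE xE P0 P1 P2.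
  apply/eqP; rewrite -subr_eq0; apply/eqP.
  have -> : 0 = (evp (Pa 0) x * evp f s * sE - evp (Pa 0) s * evp f x * xE)
     + s * (evp (Pa 1) x * evp f s * sE - evp (Pa 1) s * evp f x * xE)
     + s ^+ 2 * (evp (Pa 2%:R) x * evp f s * sE - evp (Pa 2%:R) s * evp f x * xE).
    by rewrite P0 P1 P2 !subrr !mulr0 !addr0.
  ring.
(* Subtracting the two quadratic relations and dividing by [s - x] leaves an equation linear in
   [s]. *)
have : (s - x) * ((s + x) * evp (Pa 2%:R) x + evp (Pa 1) x) = 0.
  by rewrite -[RHS](subrr 0) -{1}rels' -relx; ring.
case/D_dom => [/eqP|lin]; first by rewrite subr_eq0 (negPf s_neq_x).
have P2_neq0 : Pa 2%:R != 0.
  apply/eqP => P20; move/eqP: Pa_neq0; apply.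
  move: lin; rewrite P20 evpE mulr0 add0r => /(evp_inj dx_neq0) P10.
  move: rel; rewrite P20 P10 !mulr0 !addr0 => P00.
  by case: a {caj} => [[|[|[|//]]]] lta //; [rewrite -P00|rewrite -P10|rewrite -P20];
    congr Pa; exact: val_inj.
pose W := Pa 2%:R; pose U := - ('X * Pa 2%:R + Pa 1).
have sW : s * evp W x = evp U x.
  by rewrite /U !evpE; apply/eqP; rewrite -subr_eq0 -[X in _ == X]lin; apply/eqP; ring.
have gcd_neq0 : gcdp U W != 0 by rewrite gcdp_eq0 (negPf P2_neq0) andbF.
exists (U %/ gcdp U W), (W %/ gcdp U W); split.
- by rewrite coprimep_div_gcd // P2_neq0 orbT.
- by rewrite divp_eq0 (negPf P2_neq0) (negPf gcd_neq0) /= -leqNgt leq_gcdpr.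
apply: (D_cancel (nz dx_neq0 gcd_neq0)).
rewrite mulrCA -!evpM [_ * (_ %/ _)]mulrC divpK ?dvdp_gcdr //.
by rewrite [_ * (_ %/ _)]mulrC divpK ?dvdp_gcdl.
Qed.

(** With [s = P / Q] in lowest terms, the equations give [w P^(2n-1) f = X^(2n-1) Q^(n+2) fh], where
    [w = P' Q - P Q'] and [fh = Q^(n-1) f(P/Q)]. As [f_0 = 1], [P] is prime to [fh] as well as to
    [Q], so [P^(2n-1)] divides [X^(2n-1)]: up to a constant, [P] is 1 or [X]. A degree count
    excludes 1 and makes [Q] constant. *)
Lemma homothetic_conj : exists2 c, s = iota c * x & c ^+ (2 * n) *: f = f \Po (c *: 'X).
Proof.
have [P [Q [coPQ Q0 sQ]]] := rational_conj.
pose fh := \sum_(i < n) f`_i *: (P ^+ i * Q ^+ (n.-1 - i)).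
have fE : f = \sum_(i < n) f`_i *: 'X^i.
  rewrite -poly_def; apply/polyP => i; rewrite coef_poly; case: ltnP => // lei.
  by rewrite nth_default // (leq_trans szf).
have evfh : evp fh x = evp f s * evp Q x ^+ n.-1.
  rewrite /fh [in RHS]fE !evp_sum mulr_suml; apply: eq_bigr => i _.
  rewrite !evpE -sQ exprMn; have -> : n.-1 = (i + (n.-1 - i))%N by have := ltn_ord i; clear; lia.
  by rewrite addKn exprD; ring.
have cofh : coprimep P fh.
  have -> : fh = (\sum_(i < n.-1) f`_i.+1 *: (P ^+ i * Q ^+ (n.-1 - i.+1))) * P + Q ^+ n.-1.
    rewrite /fh; move: (prednK (leq_trans (isT : 0 < 3)%N n3)) => <-.
    rewrite big_ord_recl f0 scale1r expr0 mul1r subn0 addrC mulr_suml; congr (_ + _).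
    by apply: eq_bigr => i _; rewrite exprSr -scalerAl; congr (_ *: _); rewrite mulrAC.
  by rewrite coprimep_addl_mul coprimep_expr.
pose w := P^`() * Q - P * Q^`().
have key : w * P ^+ (2 * n - 1) * f = 'X^(2 * n - 1) * (Q ^+ n.+2 * fh).
  apply/eqP; rewrite -subr_eq0; apply/eqP; apply: (evp_inj dx_neq0); rewrite !evpE.
  have := congr1 der sQ; rewrite derM !der_evp => dsQ.
  rewrite evfh; apply: (D_cancel v_neq0); rewrite mulr0 -sQ exprMn.
  have -> : evp Q x ^+ n.+2 * (evp f s * evp Q x ^+ n.-1) =
     evp Q x ^+ 2 * evp Q x ^+ (2 * n - 1) * evp f s.
    by rewrite mulrCA -!exprD mulrC; congr (_ ^+ _ * _); move: n3; clear; lia.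
  move: (x ^+ (2 * n - 1)) x_ode (s ^+ (2 * n - 1)) s_ode (evp Q x ^+ (2 * n - 1)) sQ => X1 xo S1 so Qk sQ.
  have -> : 0 = Qk * (- X1 * S1 * evp Q x * (der s * evp Q x + s * (evp Q^`() x * der x)
     - evp P^`() x * der x)
     + (der s * S1 - v * evp f s) * (X1 * evp Q x ^+ 2)
     - (der x * X1 - v * evp f x) * (S1 * (evp P^`() x * evp Q x - s * evp Q x * evp Q^`() x))).
    by rewrite dsQ xo so !subrr; ring.
  ring.
have fh0 : fh != 0.
  apply/eqP => fh0; move: evfh; rewrite fh0 evp0 => /esym /eqP; apply/negP.
  by rewrite D_mul_neq0 ?D_exp_neq0 ?nz.
have P0 : P != 0.
  apply/eqP => P0; move: sQ; rewrite P0 evp0 => /eqP; apply/negP.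
  by rewrite D_mul_neq0 ?nz.
have PndX : P ^+ (2 * n - 1) %| 'X^(2 * n - 1).
  rewrite -(@Gauss_dvdpl _ _ (Q ^+ n.+2 * fh)) -?key; first by rewrite -mulrA mulrCA dvdp_mulr.
  by rewrite coprimep_expl // coprimepMr cofh coprimep_expr.
have n1 : (2 * n - 1 = (2 * n - 2).+1)%N by move: n3; clear; lia.
have [k _ PX] : exists2 k, (k <= 2 * n - 1)%N & P %= 'X ^+ k.
  have : P %| ('X - 0%:P) ^+ (2 * n - 1).
    by rewrite subr0; apply: dvdp_trans PndX; rewrite n1 exprS dvdp_mulr.
  by case/dvdp_exp_XsubCP => k kn; rewrite subr0 => PX; exists k.
have szP : size P = k.+1 by rewrite (eqp_size PX) size_polyXn.
have size_pow (p : {poly R}) m : p != 0 -> size (p ^+ m) = ((size p).-1 * m).+1.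
  by move=> p0; rewrite -size_exp prednK // size_poly_gt0 expf_neq0.
have k1 : (k <= 1)%N.
  have := dvdp_leq _ PndX; rewrite expf_neq0 // => /(_ isT).
  by rewrite size_pow // size_polyXn szP /=; move: n3; clear; nia.
have Q_gt0 : (0 < size Q)%N by rewrite size_poly_gt0.
have fh_gt0 : (0 < size fh)%N by rewrite size_poly_gt0.
have lhs0 : w * P ^+ (2 * n - 1) * f != 0.
  by rewrite key; apply: mulf_neq0; [|apply: mulf_neq0 => //]; apply: expf_neq0.
have szw : (size w <= k + (size Q).-1)%N.
  have szM (r t : {poly R}) a c : (size r <= a)%N -> (size t <= c)%N -> (size (r * t)%R <= (a + c).-1)%N.
    by move=> ra tc; apply: leq_trans (size_polyMleq _ _) _; move: (leq_add ra tc); clear; lia.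
  have szd (r : {poly R}) : (size r^`() <= (size r).-1)%N by rewrite size_poly.
  apply: leq_trans (size_polyD _ _) _; rewrite size_polyN geq_max; apply/andP; split.
    apply: leq_trans (szM _ _ _ _ (szd P) (leqnn _)) _.
    by rewrite szP; case: (size Q) Q_gt0 => // q _; clear; lia.
  apply: leq_trans (szM _ _ _ _ (leqnn _) (szd Q)) _.
  by rewrite szP; case: (size Q) Q_gt0 => // q _; clear; lia.
(* With [q] the degree of [Q], the left side has degree at most
   [(k + q - 1) + (2n - 1) k + (n - 1)], the right side at least [(2n - 1) + (n + 2) q]. *)
have [kE szQ] : k = 1%N /\ size Q = 1%N.
  move: lhs0; rewrite mulf_eq0 negb_or => /andP[w0 _].
  have Pn0 : P ^+ (2 * n - 1) != 0 by rewrite expf_neq0.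
  have w00 : w != 0 by apply: contraNneq w0 => ->; rewrite mul0r.
  have szMd (r t : {poly R}) : r != 0 -> t != 0 -> (size (r * t)).-1 = ((size r).-1 + (size t).-1)%N.
    move=> r0 t0; rewrite size_mul //; move: r0 t0; rewrite -!size_poly_gt0.
    by case: (size r) => // p _; case: (size t) => // q _; rewrite /= addnS.
  have := congr1 (fun p : {poly R} => (size p).-1) key; rewrite /= (szMd _ _ w0 f_neq0) (szMd _ _ w00 Pn0).
  rewrite (szMd _ _ (expf_neq0 _ X_neq0) (mulf_neq0 (expf_neq0 _ Q0) fh0)).
  rewrite (szMd _ _ (expf_neq0 _ Q0) fh0) !size_exp size_polyX szP.
  move: (n3) szw k1 Q_gt0 fh_gt0 szf; move: (size w) (size Q) (size fh) (size f); clear.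
  by case: k => [|[|//]] sw [|q] [|h] [|g]; nia.
rewrite kE expr1 in PX.
have [[c1 c2] /andP[/= c10 _] PcX] := eqpP _ _ PX.
have [d Qd] : exists d, Q = d%:P by exists Q`_0; rewrite -size1_polyC // szQ.
have d0 : d != 0 by rewrite -polyC_eq0 -Qd.
have sE : s = iota (c1^-1 * c2 / d) * x.
  apply: (D_cancel (nz ds_neq0 Q0)); rewrite Qd evpC mulrC.
  move: sQ; rewrite Qd evpC => ->.
  rewrite -[P](scalerK c10) PcX !evpE !rmorphM !mulrA -!rmorphM; congr (iota _ * _).
  by field; rewrite d0 c10.
exists (c1^-1 * c2 / d); first exact: sE.
move: (c1^-1 * c2 / d) sE => c sE.
apply/eqP; rewrite -subr_eq0; apply/eqP; apply: (evp_inj dx_neq0).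
rewrite evpB evpZ evp_comp evpZ evpX -sE; apply: (D_cancel v_neq0).
rewrite mulr0 mulrBr -s_ode {1 2}sE derM derC mul0r add0r exprMn rmorphXn.
have -> : iota c ^+ (2 * n) = iota c * iota c ^+ (2 * n - 1).
  by rewrite -exprS; congr (_ ^+ _); move: n3; clear; lia.
rewrite [v * _]mulrCA -x_ode; move: (x ^+ _) (iota c ^+ _) => X1 C1.
ring.
Qed.

(** Constant coefficients give [c^(2n) = 1] and [c^(n+1) = 1], so [f] and [b] are unchanged under
    [X -> c X]; since [c] is not 1, their linear coefficients vanish. *)
Theorem invariant_quotient_coef1 : f`_1 = 0 /\ b`_1 = 0.
Proof.
have [c sE fc] := homothetic_conj.
have cn1 : c != 1 by apply: contraNneq s_neq_x => c1; rewrite sE c1 rmorph1 mul1r.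
have c2n : c ^+ (2 * n) = 1.
  by have := congr1 (fun p : {poly R} => p`_0) fc; rewrite coefZ coef_comp_scaleX f0 mulr1 expr0 mul1r.
have bc : b = c ^+ n.+1 *: (b \Po (c *: 'X)).
  apply/eqP; rewrite -subr_eq0; apply/eqP; apply: (evp_inj dx_neq0).
  have fs : evp f s = evp f x by rewrite sE -[in LHS](evpX iota x) -evpZ -evp_comp -fc c2n scale1r.
  move: B_inv; rewrite fs => Binv.
  have nz0 : evp f x * x ^+ n.+1 != 0 by rewrite D_mul_neq0 ?D_exp_neq0 ?nz.
  apply: (D_cancel nz0); rewrite mulr0 evpB evpZ evp_comp evpZ evpX -sE rmorphXn.
  have -> : 0 = evp b x * x ^+ n.+1 * evp f x - evp b s * s ^+ n.+1 * evp f x by rewrite Binv subrr.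
  have -> : s ^+ n.+1 = iota c ^+ n.+1 * x ^+ n.+1 by rewrite sE exprMn.
  by move: (x ^+ n.+1) (iota c ^+ n.+1) => X1 C1; ring.
have c1n : c ^+ n.+1 = 1.
  have := congr1 (fun p : {poly R} => p`_0) bc; rewrite coefZ coef_comp_scaleX expr0 mul1r.
  by rewrite -[LHS]mul1r => /(mulIf b0).
have zero (r : R) : r = c * r -> r = 0.
  move=> rc; apply/eqP; move: cn1; rewrite -subr_eq0 => /mulfI c1.
  by rewrite -(inj_eq c1) mulr0 mulrBl mul1r -rc subrr.
split; apply: zero.
  have := congr1 (fun p : {poly R} => p`_1) fc.
  by rewrite c2n scale1r coef_comp_scaleX expr1.
have := congr1 (fun p : {poly R} => p`_1) bc.
by rewrite c1n scale1r coef_comp_scaleX expr1.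
Qed.

End Invariants.

(** * Formal power series *)

Definition fps (R : Type) : Type := nat -> R.

HB.instance Definition _ (R : Type) := gen_eqMixin (fps R).
HB.instance Definition _ (R : Type) := gen_choiceMixin (fps R).

Section FormalSeries.
Variable R : comNzRingType.
Implicit Types (s t r : fps R) (p q : {poly R}).

Definition trunc k s : {poly R} := \poly_(i < k) s i.

Definition agree k s p := forall i, (i < k)%N -> s i = p`_i.

Lemma agree_trunc k s : agree k s (trunc k s).
Proof. by move=> i ik; rewrite coef_poly ik. Qed.

(** Reduces identities of series to identities of polynomials at each order, from which the ring
    axioms below are inherited. *)
Lemma fps_eq s t : (forall k, exists2 p, agree k s p & agree k t p) -> s = t.
Proof.
by move=> st; apply/funext => i; have [p sp tp] := st i.+1; rewrite sp // tp.
Qed.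

Definition fps_add s t : fps R := fun i => s i + t i.
Definition fps_opp s : fps R := fun i => - s i.
Definition fps_mul s t : fps R := fun i => (trunc i.+1 s * trunc i.+1 t)`_i.
Definition fps_const c : fps R := fun i => c *+ (i == 0%N).

Lemma agree_add k s t p q : agree k s p -> agree k t q -> agree k (fps_add s t) (p + q).
Proof. by move=> sp tq i ik; rewrite coefD /fps_add sp // tq. Qed.

Lemma agree_mul k s t p q : agree k s p -> agree k t q -> agree k (fps_mul s t) (p * q).
Proof.
move=> sp tq i ik; rewrite /fps_mul !coefM; apply: eq_bigr => j _.
by have := ltn_ord j; rewrite ltnS => ji; rewrite !coef_poly !ltnS leq_subr ji sp ?tq //;
  apply: leq_ltn_trans ik; rewrite ?leq_subr.
Qed.

Lemma agree_const k c : agree k (fps_const c) c%:P.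
Proof. by move=> i ik; rewrite coefC /fps_const; case: eqP. Qed.

Fact fps_addA : associative fps_add.
Proof. by move=> s t r; apply/funext => i; rewrite /fps_add addrA. Qed.
Fact fps_addC : commutative fps_add.
Proof. by move=> s t; apply/funext => i; rewrite /fps_add addrC. Qed.
Fact fps_add0 : left_id (fps_const 0) fps_add.
Proof. by move=> s; apply/funext => i; rewrite /fps_add /fps_const mul0rn add0r. Qed.
Fact fps_addN : left_inverse (fps_const 0) fps_opp fps_add.
Proof. by move=> s; apply/funext => i; rewrite /fps_add /fps_const mul0rn addNr. Qed.

HB.instance Definition _ :=
  GRing.isZmodule.Build (fps R) fps_addA fps_addC fps_add0 fps_addN.

Lemma fps0E i : (0 : fps R) i = 0.
Proof. exact: mul0rn. Qed.

Fact fps_mulA : associative fps_mul.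
Proof.
move=> s t r; apply: fps_eq => k; exists (trunc k s * (trunc k t * trunc k r)).
  by do 2?[apply: agree_mul]; apply: agree_trunc.
by rewrite mulrA; do 2?[apply: agree_mul]; apply: agree_trunc.
Qed.
Fact fps_mulC : commutative fps_mul.
Proof.
move=> s t; apply: fps_eq => k; exists (trunc k s * trunc k t).
  by apply: agree_mul; apply: agree_trunc.
by rewrite mulrC; apply: agree_mul; apply: agree_trunc.
Qed.
Fact fps_mul1 : left_id (fps_const 1) fps_mul.
Proof.
move=> s; apply: fps_eq => k; exists (trunc k s); last exact: agree_trunc.
by rewrite -[trunc k s]mul1r; apply: agree_mul; [exact: agree_const|exact: agree_trunc].
Qed.
Fact fps_mulDl : left_distributive fps_mul +%R.
Proof.
move=> s t r; apply: fps_eq => k; exists ((trunc k s + trunc k t) * trunc k r).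
  by apply: agree_mul; [apply: agree_add|]; apply: agree_trunc.
by rewrite mulrDl; apply: agree_add; apply: agree_mul; apply: agree_trunc.
Qed.
Fact fps_1neq0 : fps_const 1 != 0.
Proof.
apply/eqP => /(congr1 (fun s : fps R => s 0%N)) e; have /eqP : 1 = 0 :> R := e.
by rewrite oner_eq0.
Qed.

HB.instance Definition _ := GRing.Zmodule_isComNzRing.Build (fps R)
  fps_mulA fps_mulC fps_mul1 fps_mulDl fps_1neq0.

Fact fps_const_is_zmod_morphism : zmod_morphism fps_const.
Proof. by move=> c d; apply/funext => i; rewrite /fps_const mulrnBl. Qed.
Fact fps_const_is_monoid_morphism : monoid_morphism fps_const.
Proof.
split=> // c d; apply: fps_eq => k; exists (c * d)%:P; first exact: agree_const.
by rewrite polyCM; apply: agree_mul; apply: agree_const.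
Qed.
HB.instance Definition _ := GRing.isZmodMorphism.Build R (fps R) fps_const fps_const_is_zmod_morphism.
HB.instance Definition _ := GRing.isMonoidMorphism.Build R (fps R) fps_const fps_const_is_monoid_morphism.

Definition fps_X : fps R := fun i => (i == 1%N)%:R.
Definition fps_der s : fps R := fun i => s i.+1 *+ i.+1.
(** The substitution [u -> - u]. *)
Definition fps_refl s : fps R := fun i => (-1) ^+ i * s i.

Lemma agree_X k : agree k fps_X 'X.
Proof. by move=> i _; rewrite coefX. Qed.

Lemma agree_der k s p : agree k.+1 s p -> agree k (fps_der s) p^`().
Proof. by move=> sp i ik; rewrite coef_deriv /fps_der sp. Qed.

Lemma agree_exp k s p m : agree k s p -> agree k (s ^+ m) (p ^+ m).
Proof.
move=> sp; elim: m => [|m IH]; first exact: agree_const.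
by rewrite !exprS; apply: agree_mul.
Qed.

Lemma agree_refl k s p : agree k s p -> agree k (fps_refl s) (p \Po (- 'X)).
Proof. by move=> sp i ik; rewrite -scaleN1r coef_comp_scaleX /fps_refl sp. Qed.

Lemma fps_der_add s t : fps_der (s + t) = fps_der s + fps_der t.
Proof. by apply/funext => i; rewrite /fps_der mulrnDl. Qed.

Lemma fps_der_mul s t : fps_der (s * t) = fps_der s * t + s * fps_der t.
Proof.
apply: fps_eq => k; exists (trunc k.+1 s * trunc k.+1 t)^`().
  by apply: agree_der; apply: agree_mul; apply: agree_trunc.
have low r : agree k r (trunc k.+1 r) by move=> i ik; apply: agree_trunc; apply: leqW.
have dlow r : agree k (fps_der r) (trunc k.+1 r)^`() by apply: agree_der; apply: agree_trunc.
by rewrite derivM; apply: agree_add; apply: agree_mul; [exact: dlow|exact: low|exact: low|exact: dlow].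
Qed.

Lemma fps_der_const c : fps_der (fps_const c) = 0.
Proof. by apply/funext => i; rewrite fps0E /fps_der /fps_const mulr0n mul0rn. Qed.

Fact fps_refl_is_zmod_morphism : zmod_morphism fps_refl.
Proof. by move=> s t; apply/funext => i; rewrite /fps_refl mulrBr. Qed.
Fact fps_refl_is_monoid_morphism : monoid_morphism fps_refl.
Proof.
split=> [|s t]; apply: fps_eq => k.
  exists 1%:P; last exact: agree_const.
  by rewrite -[1%:P](comp_polyC _ (- 'X)); apply: agree_refl; apply: agree_const.
exists ((trunc k s * trunc k t) \Po (- 'X)).
  by apply: agree_refl; apply: agree_mul; apply: agree_trunc.
by rewrite comp_polyM; apply: agree_mul; apply: agree_refl; apply: agree_trunc.
Qed.
HB.instance Definition _ := GRing.isZmodMorphism.Build (fps R) (fps R) fps_refl fps_refl_is_zmod_morphism.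
HB.instance Definition _ := GRing.isMonoidMorphism.Build (fps R) (fps R) fps_refl fps_refl_is_monoid_morphism.

Lemma fps_refl_const c : fps_refl (fps_const c) = fps_const c.
Proof.
by apply/funext => -[|i]; rewrite /fps_refl /fps_const ?expr0 ?mul1r // !mulr0n mulr0.
Qed.
Lemma fps_refl_X : fps_refl fps_X = - fps_X.
Proof.
apply/funext => -[|[|i]]; rewrite /fps_refl /fps_X /= ?mulr0 ?mulr1 ?expr1 //;
  by rewrite [RHS]oppr0.
Qed.
Lemma fps_der_refl s : fps_der (fps_refl s) = - fps_refl (fps_der s).
Proof.
apply/funext => i; rewrite -[RHS]/(- ((-1) ^+ i * (s i.+1 *+ i.+1))).
by rewrite /fps_der /fps_refl exprS mulN1r mulNr mulNrn mulrnAr.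
Qed.

Lemma agree_evp k s p q : agree k s p -> agree k (evp fps_const q s) (q \Po p).
Proof.
move=> sp; elim/poly_ind: q => [|q c IH]; first by rewrite evp0 comp_poly0 -polyC0; exact: agree_const.
rewrite !evpE comp_polyD comp_polyM comp_polyX comp_polyC.
by apply: agree_add; [exact: agree_mul|exact: agree_const].
Qed.

Lemma fps_mul_coef0 s t : (s * t) 0%N = s 0%N * t 0%N.
Proof. by rewrite [LHS]coefM big_ord1 !coef_poly. Qed.
Lemma fps_exp_coef0 s k : (s ^+ k) 0%N = s 0%N ^+ k.
Proof. by elim: k => [//|k IH]; rewrite !exprS fps_mul_coef0 IH. Qed.

End FormalSeries.

(** The lowest-order coefficient of a product is the product of the lowest-order coefficients. *)
Lemma fps_mul_eq0 (R : idomainType) (s t : fps R) : s * t = 0 -> s = 0 \/ t = 0.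
Proof.
have ord (r : fps R) : r != 0 -> exists i, r i != 0 /\ forall j, (j < i)%N -> r j = 0.
  move=> r0; have ex : exists i, r i != 0.
    apply/not_existsP => nz; move/eqP: r0; apply; apply/funext => i.
    by rewrite fps0E; have /negP := nz i; rewrite negbK => /eqP.
  exists (ex_minn ex); case: ex_minnP => i ri imin; split=> // j ji.
  by apply/eqP; apply: contraTT ji => /imin; rewrite -leqNgt.
move=> st0; have [->|s0] := eqVneq s 0; first by left.
have [->|t0] := eqVneq t 0; first by right.
have [i [si imin]] := ord _ s0; have [j [tj jmin]] := ord _ t0.
have := congr1 (fun r : fps R => r (i + j)%N) st0.
rewrite fps0E [LHS]coefM (bigD1 (Ordinal (leq_addr j i : i < (i + j).+1)%N)) //= big1 => [|l].
  rewrite addr0 addKn !coef_poly !ltnS leq_addr leq_addl => /eqP.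
  by rewrite mulf_eq0 (negPf si) (negPf tj).
rewrite -val_eqE /= neq_ltn => /orP[li|il]; rewrite !coef_poly.
  by rewrite imin // if_same mul0r.
by rewrite (jmin (i + j - l)%N) ?if_same ?mulr0 //; have := ltn_ord l; lia.
Qed.

(** * Taylor expansion of polynomials and the normalizing series *)

Lemma comp_poly_add_factor (R : comNzRingType) (q p h : {poly R}) :
  exists r, q \Po (p + h) = q \Po p + h * r.
Proof.
elim/poly_ind: q => [|q c [r IH]]; first by exists 0; rewrite !comp_poly0 mulr0 addr0.
exists (q \Po p + r * (p + h)).
by rewrite !comp_polyD !comp_polyM !comp_polyX !comp_polyC IH; ring.
Qed.

Lemma comp_poly_taylor2 (R : comNzRingType) (q p h : {poly R}) :
  exists r, q \Po (p + h) = q \Po p + h * (q^`() \Po p) + h ^+ 2 * r.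
Proof.
elim/poly_ind: q => [|q c [r IH]].
  by exists 0; rewrite deriv0 !comp_poly0 !mulr0 !addr0.
exists (q^`() \Po p + r * (p + h)).
by rewrite derivMXaddC !comp_polyD !comp_polyM !comp_polyX !comp_polyC IH; ring.
Qed.

Section Normalization.
Variables (R : numFieldType) (m : nat) (f : {poly R}).
Hypothesis f0 : f`_0 = 1.

(* With [x = u p(u)], the equation [x' x^m = u^m f(x)] becomes [ode_defect p = 0]. *)
Definition ode_defect (p : {poly R}) : {poly R} :=
  p ^+ m.+1 + 'X * p^`() * p ^+ m - (f \Po ('X * p)).

(** Modulo [X^(k+1)], adding [h = c X^k] changes the three terms by [(m + 1) h], [k h] and 0,
    because [p_0 = 1] and [X h' = k h]. *)
Lemma ode_defect_step (p : {poly R}) c k : p`_0 = 1 -> (0 < k)%N ->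
  exists r, ode_defect (p + c *: 'X^k) =
    ode_defect p + (c * (m.+1 + k)%:R) *: 'X^k + 'X^(k.+1) * r.
Proof.
move=> p0 k0; set h := c *: 'X^k.
have hd : 'X * h^`() = h *+ k.
  rewrite /h derivZ derivXn; case: k k0 @h => // k _ /=.
  by rewrite -scalerAr mulrnAr -exprS scalerMnr.
have [r0 r0E] := comp_poly_add_factor 'X^m p h; rewrite !comp_Xn_poly in r0E.
have [r1] := comp_poly_taylor2 'X^(m.+1) p h.
rewrite derivXn !comp_Xn_poly linearMn /= comp_Xn_poly => r1E.
have [r2 r2E] := comp_poly_add_factor f ('X * p) ('X * h).
have [r3 r3E] : exists r3, p ^+ m = 1 + 'X * r3.
  have [r3] := comp_poly_add_factor 'X^m 1 (p - 1).
  rewrite !comp_Xn_poly addrCA subrr addr0 expr1n => r3E.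
  have /factor_theorem [q pq] : root (p - 1) 0.
    by rewrite /root hornerD hornerN hornerC horner_coef0 p0 subrr.
  by exists (q * r3); rewrite r3E pq subr0; ring.
have hX : h = 'X^k * c%:P by rewrite mulrC mul_polyC.
have [k' kE] : exists k', k = k'.+1 by case: k k0 {h hX hd r0E r2 r1E r2E} => // k; exists k.
exists (c%:P * (r3 *+ (m.+1 + k) + 'X^k' * c%:P * r1 + p^`() * r0 + 'X^k' * c%:P * r0 *+ k - r2)).
rewrite /ode_defect derivD (mulrDr 'X p h) (mulrDr 'X p^`()) r2E hd r1E r0E r3E.
rewrite -mul_polyC polyCM polyC_natr hX.
have -> : 'X^(k.+1) = 'X * 'X^k :> {poly R} by rewrite exprS.
have -> : 'X^k = 'X * 'X^k' :> {poly R} by rewrite kE exprS.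
ring.
Qed.

(** In characteristic 0 the factor [m + 1 + k] is invertible, so each coefficient of the solution is
    determined by the preceding ones. *)
Lemma ode_poly : exists P : nat -> {poly R}, forall k,
  [/\ (P k)`_0 = 1, exists r, ode_defect (P k) = 'X^(k.+1) * r &
      exists r, P k.+1 = P k + 'X^(k.+1) * r].
Proof.
pose step k (p : {poly R}) :=
  p + (- (ode_defect p)`_(k.+1) / (m.+1 + k.+1)%:R) *: 'X^(k.+1).
pose P := fix P k := if k is k'.+1 then step k' (P k') else 1.
have P0 k : (P k)`_0 = 1.
  elim: k => [|k IH] /=; first by rewrite coef1.
  by rewrite coefD coefZ coefXn mulr0 addr0.
exists P => k; split=> //; last first.
  by exists (- (ode_defect (P k))`_(k.+1) / (m.+1 + k.+1)%:R)%:P; rewrite mulrC mul_polyC.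
elim: k => [|k [r IH]].
  have [r rE] := comp_poly_add_factor f 0 'X.
  exists (- r); rewrite /ode_defect /= -polyC1 derivC !expr1n !mulr0 mul0r addr0.
  rewrite polyC1 mulr1 expr1 -[X in f \Po X]add0r rE.
  rewrite comp_poly0r f0 polyC1; ring.
have [t tE] := ode_defect_step (- (ode_defect (P k))`_(k.+1) / (m.+1 + k.+1)%:R) (P0 k) (ltn0Sn k).
have k0 : (m.+1 + k.+1)%:R != 0 :> R by rewrite pnatr_eq0.
have [r' rE] : exists r', r = (r`_0)%:P + 'X * r'.
  have /factor_theorem [q rq] : root (r - (r`_0)%:P) 0.
    by rewrite /root hornerD hornerN hornerC horner_coef0 subrr.
  by exists q; rewrite -[LHS](subrK (r`_0)%:P) rq polyC0 subr0; ring.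
exists (r' + t); rewrite /= tE divfK // IH coefXnM ltnn subnn.
rewrite {1}rE -mul_polyC polyCN; set c := (r`_0)%:P.
have -> : 'X^(k.+2) = 'X * 'X^(k.+1) :> {poly R} by rewrite exprS.
by ring.
Qed.

Theorem normalizing_series : exists xi : fps R,
  [/\ xi 0%N = 0, xi 1%N = 1 &
      fps_der xi * xi ^+ m = @fps_X R ^+ m * evp (@fps_const R) f xi].
Proof.
have [P PE] := ode_poly.
have stable k j i : (i <= k)%N -> (P (k + j)%N)`_i = (P k)`_i.
  move=> ik; elim: j => [|j IH]; first by rewrite addn0.
  have [_ _ [r rE]] := PE (k + j)%N; rewrite addnS rE coefD coefXnM IH.
  by rewrite ltnS (leq_trans ik) ?leq_addr // addr0.
(* The coefficient of [X^i] in [P k] is final from [k = i] on, so the diagonal is the limit; the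
   index is shifted because [x = u p(u)]. *)
pose xi : fps R := fun i => if i is i'.+1 then (P i')`_i' else 0.
have agr k : agree k.+2 xi ('X * P k).
  case=> [|i] ik; rewrite coefXM //=.
  by rewrite -(stable i (k - i)%N) // subnKC.
exists xi; split=> //; first by have [] := PE 0%N.
apply: fps_eq => k; have [P0 [r dE] _] := PE k.
have agr' : agree k xi ('X * P k) by move=> i ik; apply: agr; rewrite ltnW // ltnW.
exists ('X^m * (f \Po ('X * P k))); last first.
  by apply: agree_mul; [apply: agree_exp; exact: agree_X|exact: agree_evp].
have agrl : agree k (fps_der xi * xi ^+ m) (('X * P k)^`() * ('X * P k) ^+ m).
  apply: agree_mul; last exact: agree_exp.
  by apply: agree_der => i ik; apply: agr; exact: ltnW.
move=> i ik; rewrite (agrl i ik); apply/eqP; rewrite -subr_eq0 -coefB.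
have -> : ('X * P k)^`() * ('X * P k) ^+ m - 'X^m * (f \Po ('X * P k)) =
          'X^(k.+1) * (r * 'X^m).
  rewrite mulrA -dE /ode_defect derivM derivX exprMn exprS; ring.
by rewrite coefXnM ltnS ltnW.
Qed.
End Normalization.

Local Notation feval := (evp (@fps_const _)).

Lemma feval_coef0 (R : comNzRingType) (p : {poly R}) (s : fps R) :
  feval p s 0%N = p.[s 0%N].
Proof.
elim/poly_ind: p => [|p c IH]; first by rewrite evp0 horner0 fps0E.
rewrite !evpE hornerMXaddC -IH -fps_mul_coef0.
by rewrite -[LHS]/((feval p s * s) 0%N + c *+ (0 == 0)%N).
Qed.

Lemma feval_refl (R : comNzRingType) (p : {poly R}) (s : fps R) :
  fps_refl (feval p s) = feval p (fps_refl s).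
Proof.
elim/poly_ind: p => [|p c IH]; first by rewrite !evp0 rmorph0.
by rewrite !evpE rmorphD rmorphM /= IH fps_refl_const.
Qed.

Lemma fps_factor_X (R : comNzRingType) (s : fps R) :
  s 0%N = 0 -> s = @fps_X R * (fun i => s i.+1).
Proof.
move=> s0; apply: fps_eq => k; exists (trunc k s); first exact: agree_trunc.
have -> : trunc k s = 'X * trunc k.-1 (fun i => s i.+1).
  apply/polyP => -[|i]; rewrite coefXM !coef_poly; first by rewrite s0 if_same.
  by case: k.
move=> i ik; rewrite [LHS](agree_mul (@agree_X _ i.+1) (@agree_trunc _ i.+1 _)) //.
rewrite !coefXM; case: i ik => // i ik; rewrite !coef_poly /= ltnS leqnSn.
by case: k ik => // k; rewrite ltnS => ->.
Qed.

(** For [b_0 <> 0] the algebraic theorem applies with [s = xi(-u)]. For [b_0 = 0] the quotient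
    starts with [b_1 u^(n+2)], of odd exponent, so evenness gives [b_1 = 0]. *)
Theorem even_quotient (R : numFieldType) (n : nat) (f b : {poly R}) (xi : fps R) :
  (3 <= n)%N -> odd n -> f`_0 = 1 -> (size f <= n)%N -> (size b <= n.-1)%N ->
  xi 0%N = 0 -> xi 1%N = 1 ->
  fps_der xi * xi ^+ (2 * n - 1) = @fps_X R ^+ (2 * n - 1) * feval f xi ->
  feval b xi * xi ^+ n.+1 * feval f (fps_refl xi) =
    feval b (fps_refl xi) * fps_refl xi ^+ n.+1 * feval f xi ->
  b`_1 = 0 /\ (b`_0 = 0 \/ f`_1 = 0).
Proof.
move=> n3 nodd f0 szf szb xi0 xi1 ode inv.
have X0 : @fps_X R != 0.
  by apply/eqP => /(congr1 (fun s : fps R => s 1%N)) /eqP; rewrite fps0E oner_eq0.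
have [b0|b0] := eqVneq b`_0 0; last first.
  suff [] : f`_1 = 0 /\ b`_1 = 0 by split => //; right.
  apply: (@invariant_quotient_coef1 R (fps R) (@fps_const R) (@fps_der R) (@fps_mul_eq0 R)
    (@fps_der_add R) (@fps_der_mul R) (@fps_der_const R) n f b xi (fps_refl xi)
    (@fps_X R ^+ (2 * n - 1))) => //.
  - by apply: D_exp_neq0 => //; exact: fps_mul_eq0.
  - apply/eqP => /(congr1 (fun s : fps R => s 0%N)); rewrite fps0E /fps_der xi1 => /eqP.
    by rewrite oner_eq0.
  - apply/eqP => /(congr1 (fun s : fps R => s 0%N)); rewrite fps0E /fps_der /fps_refl xi1 => /eqP.
    by rewrite expr1 mulr1 oppr_eq0 oner_eq0.
  - apply/eqP => /(congr1 (fun s : fps R => s 1%N)); rewrite /fps_refl xi1 expr1 mulr1 => /eqP.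
    by rewrite -subr_eq0 -opprD oppr_eq0 (pnatr_eq0 R 2).
  (* The reflection changes the sign of the derivation and, [2n - 1] being odd, that of [u^(2n-1)];
     so [xi(-u)] solves the same equation. *)
  - rewrite fps_der_refl -rmorphXn mulNr -rmorphM /= ode rmorphM rmorphXn /= fps_refl_X feval_refl.
    by rewrite exprNn -signr_odd (_ : odd (2 * n - 1)) ?expr1 ?mulN1r ?mulNr ?opprK //; lia.
split; last by left.
have [c bE] : exists c, b = c * 'X.
  by have /factor_theorem [c] : root b 0; [rewrite /root horner_coef0 b0|rewrite subr0; exists c].
pose y : fps R := fun i => xi i.+1; have xiE : xi = @fps_X R * y by exact: fps_factor_X.
have reflE : fps_refl xi = - @fps_X R * fps_refl y by rewrite xiE rmorphM /= fps_refl_X.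
have key : feval c xi * y ^+ n.+2 * feval f (fps_refl xi) =
    - (feval c (fps_refl xi) * fps_refl y ^+ n.+2 * feval f xi).
  apply: (D_cancel (@fps_mul_eq0 R) (D_exp_neq0 (@fps_mul_eq0 R) n.+2 X0)).
  have xin : xi * xi ^+ n.+1 = @fps_X R ^+ n.+2 * y ^+ n.+2 by rewrite -exprS {1}xiE exprMn.
  have refln : fps_refl xi * fps_refl xi ^+ n.+1 = - (@fps_X R ^+ n.+2 * fps_refl y ^+ n.+2).
    by rewrite -exprS {1}reflE exprMn exprNn -signr_odd /= negbK nodd expr1 !mulN1r mulNr.
  move: inv; rewrite bE !evpE -[_ * xi * _]mulrA xin -[_ * fps_refl xi * _]mulrA refln.
  move: (@fps_X R ^+ _) (y ^+ _) (fps_refl y ^+ _) => Xn yn zn inv.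
  transitivity (feval c xi * (Xn * yn) * feval f (fps_refl xi)); first by ring.
  by rewrite inv; ring.
have := congr1 (fun s : fps R => s 0%N) key.
have oppE (s : fps R) : (- s) 0%N = - s 0%N by [].
rewrite oppE !fps_mul_coef0 !fps_exp_coef0 !feval_coef0 /fps_refl xi0 mulr0 !horner_coef0.
rewrite /y xi1 expr0 mulr1 !expr1n f0 !mulr1 => /eqP; rewrite -addr_eq0 -mulr2n mulrn_eq0 /=.
by rewrite bE coefMX /= => /eqP.
Qed.

(** * Polynomials modulo a power of the variable *)

Section Congruence.
Variable R : fieldType.
Implicit Types p q r s u : {poly R}.

Definition eqmodX k p q := 'X^k %| p - q.

Lemma eqmodX_coefP k p q : reflect (forall i, (i < k)%N -> p`_i = q`_i) (eqmodX k p q).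
Proof.
apply: (iffP idP) => [/dvdpP [r rE] i ik|pq].
  by apply/eqP; rewrite -subr_eq0 -coefB rE coefMXn ik.
rewrite /eqmodX -(poly_take_drop k (p - q)) dvdp_addl ?dvdp_mulIr //.
suff -> : take_poly k (p - q) = 0 by rewrite dvdp0.
by apply/polyP => i; rewrite coef_take_poly coef0; case: ltnP => // /pq; rewrite coefB => ->; rewrite subrr.
Qed.

Lemma eqmodXxx k p : eqmodX k p p.
Proof. by rewrite /eqmodX subrr dvdp0. Qed.

Lemma eqmodX_sym k p q : eqmodX k p q -> eqmodX k q p.
Proof. by move/eqmodX_coefP => pq; apply/eqmodX_coefP => i /pq. Qed.

Lemma eqmodX_trans k p q r : eqmodX k p q -> eqmodX k q r -> eqmodX k p r.
Proof.
by move=> /eqmodX_coefP pq /eqmodX_coefP qr; apply/eqmodX_coefP => i ik; rewrite pq ?qr.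
Qed.

Lemma eqmodX_le k l p q : (k <= l)%N -> eqmodX l p q -> eqmodX k p q.
Proof. by move=> kl; apply: dvdp_trans; apply: dvdp_exp2l. Qed.

Lemma eqmodXM k p q r s : eqmodX k p q -> eqmodX k r s -> eqmodX k (p * r) (q * s).
Proof.
move=> pq rs; rewrite /eqmodX.
have -> : p * r - q * s = (p - q) * r + q * (r - s) by ring.
by apply: dvdp_add; [exact: dvdp_mulr|exact: dvdp_mull].
Qed.

Lemma eqmodX_compl k p q r : eqmodX k p q -> eqmodX k (r \Po p) (r \Po q).
Proof.
move=> pq; have [t tE] := comp_poly_add_factor r q (p - q).
by move: tE; rewrite addrCA subrr addr0 => ->; rewrite /eqmodX addrC addKr dvdp_mulr.
Qed.

Lemma eqmodX_compr k p q r : r`_0 = 0 -> eqmodX k p q -> eqmodX k (p \Po r) (q \Po r).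
Proof.
move=> r0 /dvdpP [t tE]; rewrite /eqmodX -comp_polyB tE comp_polyM comp_Xn_poly.
apply: dvdp_mull; have /factor_theorem [c ->] : root r 0 by rewrite /root horner_coef0 r0.
by rewrite subr0 exprMn dvdp_mulIr.
Qed.

Lemma eqmodX_deriv k p q : eqmodX k.+1 p q -> eqmodX k p^`() q^`().
Proof.
by move/eqmodX_coefP => pq; apply/eqmodX_coefP => i ik; rewrite !coef_deriv pq.
Qed.

(** Since [p'(u) = 1] modulo [X], subtracting the leading term of the error [p(u) - X] from [u]
    raises the order of the error by one. *)
Lemma comp_poly_inverse p : p`_0 = 0 -> p`_1 = 1 -> forall k,
  exists u, [/\ u`_0 = 0, u`_1 = 1 & eqmodX k (p \Po u) 'X].
Proof.
move=> p0 p1 k; suff [u [u0 u1 pu]] : exists u, [/\ u`_0 = 0, u`_1 = 1 & eqmodX k.+2 (p \Po u) 'X].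
  by exists u; split=> //; apply: eqmodX_le pu; rewrite ltnW.
have [q pE] : exists q, p = q * 'X.
  by have /factor_theorem [q pq] : root p 0; [rewrite /root horner_coef0 p0|exists q; rewrite pq subr0].
have q0 : q`_0 = 1 by rewrite -p1 pE coefMX.
elim: k => [|k [u [u0 u1 /dvdpP [r rE]]]].
  exists 'X; split; rewrite ?coefX // comp_polyXr; apply/eqmodX_coefP => -[|[|//]] _.
    by rewrite p0 coefX.
  by rewrite p1 coefX.
exists (u - r`_0 *: 'X^(k.+2)); split.
- by rewrite coefB coefZ coefXn u0 mulr0 subr0.
- by rewrite coefB coefZ coefXn u1 mulr0 subr0.
have [t tE] := comp_poly_taylor2 p u (- (r`_0 *: 'X^(k.+2))).
have [t' t'E] : exists t', p^`() \Po u = 1 + 'X * t'.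
  have /factor_theorem [t' t'E] : root (p^`() \Po u - 1) 0.
    rewrite /root hornerD hornerN hornerC horner_comp [u.[0]]horner_coef0 u0 horner_coef0.
    by rewrite coef_deriv p1 subrr.
  by exists t'; rewrite -[LHS](subrK 1) t'E polyC0 subr0; ring.
have [r' r'E] : exists r', r = (r`_0)%:P + 'X * r'.
  have /factor_theorem [s sE] : root (r - (r`_0)%:P) 0.
    by rewrite /root hornerD hornerN hornerC horner_coef0 subrr.
  by exists s; rewrite -[LHS](subrK (r`_0)%:P) sE polyC0 subr0; ring.
rewrite /eqmodX tE t'E; set c := (r`_0)%:P in r'E *; rewrite -mul_polyC -/c.
have -> : (p \Po u) + - (c * 'X^(k.+2)) * (1 + 'X * t') + (- (c * 'X^(k.+2))) ^+ 2 * t - 'X =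
   (p \Po u - 'X) - c * 'X^(k.+2) + 'X * 'X^(k.+2) * ('X^(k.+1) * c ^+ 2 * t - c * t').
  have -> : 'X^(k.+2) = 'X * 'X^(k.+1) :> {poly R} by rewrite exprS.
  by ring.
rewrite rE {1}r'E.
have -> : (c + 'X * r') * 'X^(k.+2) - c * 'X^(k.+2) = 'X * 'X^(k.+2) * r' by ring.
by rewrite -exprS dvdp_add // dvdp_mulr.
Qed.
End Congruence.

(* [u] is a truncation of the inverse of [xi], and [E + c X^k] is a truncation of the quotient
   [xi^(n+1) b(xi) / f(xi)], with [c] its first odd coefficient. *)
Lemma normal_form (R : numFieldType) (n : nat) (f b : {poly R}) (xi : fps R) :
  (3 <= n)%N -> f`_0 = 1 -> xi 0%N = 0 -> xi 1%N = 1 ->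
  fps_der xi * xi ^+ (2 * n - 1) = @fps_X R ^+ (2 * n - 1) * feval f xi ->
  feval b xi * xi ^+ n.+1 * feval f (fps_refl xi) !=
    feval b (fps_refl xi) * fps_refl xi ^+ n.+1 * feval f xi ->
  exists (u E : {poly R}) (c : R) (k : nat),
    [/\ odd k, c != 0, E \Po (- 'X) = E & 'X^(n.+1) %| E] /\
    [/\ u`_0 = 0, u`_1 = 1, eqmodX (2 * n + k) (u^`() * u ^+ (2 * n - 1) * f) 'X^(2 * n - 1) &
        eqmodX k.+1 (b * 'X^(n.+1)) (f * (E \Po u + c *: u ^+ k))].
Proof.
move=> n3 f0 xi0 xi1 ode; set lhs := (X in X != _); set rhs := (X in _ != X) => inv.
have [K neqK] : exists K, lhs K != rhs K.
  apply/not_existsP => eqK; move/eqP: inv; apply; apply/funext => i.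
  by apply/eqP; move/negP: (eqK i); rewrite negbK.
(* Congruences up to order [2 * n + k] with [k <= K] are needed, and differentiation loses one
   order. *)
pose M := (K + 2 * n + 3)%N; pose x := trunc M xi.
have agr : agree M xi x by exact: agree_trunc.
have x0 : x`_0 = 0 by rewrite -agr // /M; lia.
have x1 : x`_1 = 1 by rewrite -agr // /M; lia.
(* [g] inverts [f(x)] modulo [X^M], so that [P] below truncates the quotient [B(xi) / f(xi)]. *)
have [g gE] : exists g, eqmodX M ((f \Po x) * g) 1.
  have : coprimep (f \Po x) 'X^M.
    apply: coprimep_expr; rewrite -[X in coprimep _ X]subr0 -polyC0 coprimep_XsubC.
    by rewrite /root horner_comp [x.[0]]horner_coef0 x0 horner_coef0 f0 oner_eq0.
  move/Bezout_eq1_coprimepP => [[u v] /= uv]; exists u.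
  by rewrite /eqmodX -uv mulrC opprD addrA subrr sub0r dvdpNr dvdp_mull.
pose B := b * 'X^(n.+1).
pose P := (B \Po x) * g.
have fP : eqmodX M ((f \Po x) * P) (B \Po x).
  have -> : (f \Po x) * P = (B \Po x) * ((f \Po x) * g) by rewrite /P; ring.
  by rewrite -[X in eqmodX _ _ X]mulr1; apply: eqmodXM => //; apply: eqmodXxx.
have agrB (s : fps R) p : agree M s p -> agree M (feval b s * s ^+ n.+1) (B \Po p).
  move=> sp; rewrite /B comp_polyM comp_Xn_poly.
  by apply: agree_mul; [exact: agree_evp|exact: agree_exp].
(* If all odd coefficients of [P] up to order [K] vanished, both sides of the invariance would agree
   at [K]. *)
have [j [oddj Pj jK]] : exists j, [/\ odd j, P`_j != 0 & (j <= K)%N].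
  apply/not_existsP => noj; move/eqP: neqK; apply.
  have agr' := agree_refl agr; have KM : (K < M)%N by rewrite /M; lia.
  have Peven : eqmodX K.+1 (P \Po (- 'X)) P.
    apply/eqmodX_coefP => i iK; rewrite -scaleN1r coef_comp_scaleX -signr_odd.
    case oddi : (odd i); last by rewrite expr0 mul1r.
    suff -> : P`_i = 0 by rewrite mulr0.
    by apply/eqP; apply: contra_notT (noj i) => Pi; rewrite oddi Pi.
  rewrite /lhs /rhs [LHS](agree_mul (agrB _ _ agr) (agree_evp f agr')) //.
  rewrite [RHS](agree_mul (agrB _ _ agr') (agree_evp f agr)) //.
  have X0 : (- 'X : {poly R})`_0 = 0 by rewrite coefN coefX oppr0.
  have fPr := eqmodX_compr X0 fP; rewrite comp_polyM -!comp_polyA in fPr.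
  have lt : (K.+1 <= M)%N by [].
  apply/(@eqmodX_coefP _ K.+1) => //.
  apply: (@eqmodX_trans _ _ _ ((f \Po x) * P * (f \Po (x \Po - 'X)))).
    by apply: eqmodXM (eqmodXxx _ _); apply: eqmodX_sym; apply: eqmodX_le fP.
  apply: (@eqmodX_trans _ _ _ ((f \Po (x \Po - 'X)) * (P \Po - 'X) * (f \Po x))).
    have -> : (f \Po x) * P * (f \Po (x \Po - 'X)) = (f \Po (x \Po - 'X)) * P * (f \Po x) by ring.
    apply: eqmodXM (eqmodXxx _ _); apply: eqmodXM; first exact: eqmodXxx.
    exact: eqmodX_sym.
  by apply: eqmodXM (eqmodXxx _ _); apply: eqmodX_le fPr.
have ex : exists j, odd j && (P`_j != 0) by exists j; rewrite oddj.
case: (ex_minnP ex) => k /andP[oddk Pk] kmin.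
have kK : (k <= K)%N by apply: leq_trans jK; apply: kmin; rewrite oddj.
have [u [u0 u1 xu]] := comp_poly_inverse x0 x1 M.
have fxu : eqmodX M ((f \Po x) \Po u) f.
  by rewrite -comp_polyA -[X in eqmodX _ _ X]comp_polyXr; apply: eqmodX_compl.
(* [E] is the part of [P] below its first odd coefficient, hence even. *)
exists u, (\poly_(i < k) P`_i), P`_k, k; split; split=> //.
- apply/polyP => i; rewrite -scaleN1r coef_comp_scaleX coef_poly -signr_odd.
  case oddi : (odd i); last by rewrite expr0 mul1r.
  case: ltnP => ik; last by rewrite mulr0.
  suff -> : P`_i = 0 by rewrite mulr0.
  by apply/eqP; apply: contraTT ik => Pi; rewrite -leqNgt kmin // oddi.
- have -> : \poly_(i < k) P`_i = (\poly_(i < k) P`_i) - 0 by rewrite subr0.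
  apply/eqmodX_coefP => i iln; rewrite coef0 coef_poly; case: ifP => // _.
  have : 'X^(n.+1) %| P - 0.
    rewrite subr0 /P /B comp_polyM comp_Xn_poly.
    have /factor_theorem [q ->] : root x 0 by rewrite /root horner_coef0 x0.
    by rewrite subr0 exprMn mulrC dvdp_mull // dvdp_mull // dvdp_mulIr.
  by move/eqmodX_coefP => /(_ i iln); rewrite coef0.
(* [u] is substituted in the equation of [x]; from [x(u) = X] follows [x'(u) u' = 1]. *)
- have odeX : eqmodX M.-1 (x^`() * x ^+ (2 * n - 1)) ('X^(2 * n - 1) * (f \Po x)).
    have le : agree M.-1 xi x by move=> i ik; apply: agr; apply: leq_trans ik _; rewrite leq_pred.
    apply/eqmodX_coefP => i iM.
    rewrite -(@agree_mul _ _ (fps_der xi) (xi ^+ (2 * n - 1)) _ _ _ _ i iM); last 2 first.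
    + by apply: agree_der; rewrite prednK // /M !addnS.
    + exact: agree_exp.
    rewrite -[LHS]/((fps_der xi * xi ^+ (2 * n - 1)) i) ode.
    by apply: (agree_mul _ _ iM); [apply: agree_exp; apply: agree_X|apply: agree_evp].
  have le : (2 * n + k <= M.-1)%N by move: kK; rewrite /M; clear; lia.
  have := eqmodX_compr u0 odeX; rewrite !comp_polyM !comp_Xn_poly => odeU.
  have dxu : eqmodX M.-1 ((x^`() \Po u) * u^`()) 1.
    rewrite -deriv_comp -[X in eqmodX _ _ X]derivX; apply: eqmodX_deriv.
    by rewrite prednK // /M !addnS.
  have fxu' : eqmodX M.-1 ((f \Po x) \Po u) f by apply: eqmodX_le fxu; rewrite leq_pred.
  have xu' : eqmodX M.-1 (x \Po u) 'X by apply: eqmodX_le xu; rewrite leq_pred.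
  apply: eqmodX_le le _.
  apply: (@eqmodX_trans _ _ _ (u^`() * (u ^+ (2 * n - 1) * ((f \Po x) \Po u)))).
    rewrite -mulrA; apply: eqmodXM; first exact: eqmodXxx.
    by apply: eqmodXM; [exact: eqmodXxx|exact: eqmodX_sym].
  apply: (@eqmodX_trans _ _ _ (u^`() * ((x^`() \Po u) * ((x ^+ (2 * n - 1)) \Po u)))).
    by apply: eqmodXM; [exact: eqmodXxx|exact: eqmodX_sym].
  rewrite mulrA [u^`() * _]mulrC -[X in eqmodX _ _ X]mul1r; apply: eqmodXM => //.
  by rewrite -(comp_Xn_poly x) -comp_polyA -[X in eqmodX _ _ X]comp_polyXr; apply: eqmodX_compl.
- have BE : eqmodX M B (f * (P \Po u)).
    apply: (@eqmodX_trans _ _ _ ((B \Po x) \Po u)).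
      apply: eqmodX_sym.
      by rewrite -comp_polyA -[X in eqmodX _ _ X]comp_polyXr; apply: eqmodX_compl.
    apply: (@eqmodX_trans _ _ _ (((f \Po x) \Po u) * (P \Po u))).
      by rewrite -comp_polyM; apply: eqmodX_compr => //; apply: eqmodX_sym.
    exact: eqmodXM fxu (eqmodXxx _ _).
  have kM : (k.+1 <= M)%N by move: kK; rewrite /M; clear; lia.
  apply: eqmodX_trans (eqmodX_le kM BE) _; apply: eqmodXM; first exact: eqmodXxx.
  rewrite -comp_Xn_poly -comp_polyZ -comp_polyD; apply: eqmodX_compr => //.
  apply/eqmodX_coefP => i; rewrite ltnS coefD coef_poly coefZ coefXn leq_eqVlt.
  by case/predU1P => [->|ik]; rewrite ?ltnn ?eqxx ?mulr1 ?add0r // ik (ltn_eqF ik) mulr0 addr0.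
Qed.

(** * Calculus of one real variable *)

Section Calculus.
Variable R : realType.
Implicit Types (f g df : R -> R) (a b t : R).

Lemma is_derive_continuous f t d : is_derive t 1 f d -> {for t, continuous f}.
Proof. by move=> fd; apply/differentiable_continuous/derivable1_diffP. Qed.

Lemma nonincreasing_derive f df a b : a <= b -> {within `[a, b], continuous f} ->
  (forall t, a < t < b -> is_derive t 1 f (df t)) ->
  (forall t, a < t < b -> df t <= 0) -> f b <= f a.
Proof.
rewrite le_eqVlt => /predU1P[-> //|ab] cf fd df0.
have [c cab e] := MVT ab (fun x xab => fd x (etrans (esym (in_itv _ _)) xab)) cf.
rewrite in_itv /= in cab; rewrite -subr_le0 e.
by apply: mulr_le0_ge0; [exact: df0|rewrite subr_ge0 ltW].
Qed.

Lemma decreasing_derive f df a b : a < b -> {within `[a, b], continuous f} ->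
  (forall t, a < t < b -> is_derive t 1 f (df t)) ->
  (forall t, a < t < b -> df t < 0) -> f b < f a.
Proof.
move=> ab cf fd df0.
have [c cab e] := MVT ab (fun x xab => fd x (etrans (esym (in_itv _ _)) xab)) cf.
by rewrite in_itv /= in cab; rewrite -subr_lt0 e nmulr_rlt0 ?subr_gt0 ?df0.
Qed.

Lemma increasing_derive f df a b : a < b -> {within `[a, b], continuous f} ->
  (forall t, a < t < b -> is_derive t 1 f (df t)) ->
  (forall t, a < t < b -> 0 < df t) -> f a < f b.
Proof.
move=> ab cf fd df0; rewrite -ltrN2.
apply: (@decreasing_derive (- f) (fun t => - df t) a b) => //.
- by move=> x; apply: continuousN; exact: cf.
- by move=> t /fd ft; apply: is_deriveN.
- by move=> t /df0; rewrite oppr_lt0.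
Qed.

Lemma derive_pos_local f t d : is_derive t 1 f d -> 0 < d ->
  exists2 e, 0 < e & forall s, t < s <= t + e -> f t < f s /\ f (t - (s - t)) < f t.
Proof.
move=> /is_derive1_caratheodory [g [fE gc gt]] d0.
have /nbhs_ballP [e /= e0 eg] : \forall z \near t, 0 < g z.
  by have /cvgr_gt := gc; apply; rewrite gt.
exists (e / 2); first by rewrite divr_gt0.
move=> s /andP[ts se]; split.
  rewrite -subr_gt0 fE mulr_gt0 ?subr_gt0 //; apply: (eg s).
  by rewrite /ball /= ltr_norml; apply/andP; split; lra.
rewrite -subr_lt0 fE pmulr_rlt0; first by lra.
by apply: (eg (t - (s - t))); rewrite /ball /= ltr_norml; apply/andP; split; lra.
Qed.

Lemma first_hitting f a b c : a <= b -> continuous f -> f a < c -> c <= f b ->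
  exists t, [/\ a < t <= b, f t = c & forall s, a <= s < t -> f s < c].
Proof.
move=> ab cf fac cfb.
pose A : set R := `[a, b] `&` [set t | c <= f t].
have cA : compact A.
  apply: compact_closedI; first exact: segment_compact.
  by apply: (@closed_comp _ _ f [set u | c <= u]) => [x _|]; [exact: cf|exact: closed_ge].
have A0 : A !=set0 by exists b; split => //=; rewrite in_itv /= ab lexx.
have [|t] := @compact_EVT_min R R (@id R) A A0 cA.
  by apply: continuous_subspaceT => x; exact: cvg_id.
move=> /set_mem [/=]; rewrite in_itv /= => /andP[ta tb] cft tmin.
have below s : a <= s < t -> f s < c.
  move=> /andP[as_ st]; rewrite ltNge; apply/negP => cfs.
  have : t <= s by apply: tmin; apply/mem_set; split => //=; rewrite in_itv /= as_ ltW // (lt_le_trans st).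
  by rewrite leNgt st.
have at_ : a < t by rewrite lt_neqAle ta andbT; apply: contraTneq cft => <-; rewrite -ltNge.
exists t; split=> //; first by rewrite at_.
apply/eqP; rewrite eq_le cft andbT leNgt; apply/negP => cltft.
have [||s] := @IVT R f a t c ta.
- by apply: continuous_subspaceT.
- by rewrite (min_idPl _) ?(max_idPr _) ?(ltW fac) ?(ltW cltft) // ltW // (lt_trans fac).
rewrite in_itv /= => /andP[as_ st] fs.
have : s < t by rewrite lt_neqAle st andbT; apply: contraTneq cltft => <-; rewrite fs ltxx.
by move=> lt_st; have := below s; rewrite as_ lt_st fs ltxx => /(_ isT).
Qed.

(** Makes [y] a parameter on a half orbit. Its speed [x^(2n-1)] vanishes at the two crossings, so
    the inverse is only claimed to be continuous at the endpoints. *)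
Lemma inverse_increasing f df a b : a < b ->
  (forall t, is_derive t 1 f (df t)) -> (forall t, a < t < b -> 0 < df t) ->
  exists g, [/\ g (f a) = a, g (f b) = b, {within `[f a, f b], continuous g} &
    forall v, f a < v < f b -> [/\ a < g v < b, f (g v) = v & is_derive v 1 g (df (g v))^-1]].
Proof.
move=> ab fd df0.
have cf : continuous f by move=> t; exact: (is_derive_continuous (fd t)).
have mono s t : a <= s -> s < t -> t <= b -> f s < f t.
  move=> as_ st tb; apply: (@increasing_derive f df s t) => //.
    exact: continuous_subspaceT.
  by move=> u /andP[su ut]; apply: df0; rewrite (le_lt_trans as_ su) (lt_le_trans ut tb).
have exg v : exists t, f a <= v <= f b -> a <= t <= b /\ f t = v.
  have [/andP[fav vfb]|nv] := boolP (f a <= v <= f b); last by exists 0.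
  have lef := ltW (mono _ _ (lexx a) ab (lexx b)).
  have [||t tab ft] := @IVT R f a b v (ltW ab).
  - exact: continuous_subspaceT.
  - by rewrite (min_idPl lef) (max_idPr lef) fav vfb.
  by exists t => _; split=> //; move: tab; rewrite in_itv.
have [g gE] := choice exg.
have wmono s t : a <= s -> s <= t -> t <= b -> f s <= f t.
  by rewrite (le_eqVlt s) => as_ /predU1P[-> //|st] tb; exact/ltW/mono.
have lef t : a <= t <= b -> f a <= f t <= f b.
  by move=> /andP[at_ tb]; rewrite !wmono.
have gK : {in `[a, b], cancel f g}.
  move=> t; rewrite in_itv /= => tab; have [gab fgt] := gE _ (lef _ tab).
  move: tab gab => /andP[at_ tb] /andP[ga gb].
  have [lt|lt|//] := ltgtP (g (f t)) t.
    by have := mono _ _ ga lt tb; rewrite fgt ltxx.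
  by have := mono _ _ at_ lt gb; rewrite fgt ltxx.
exists g; split.
- by rewrite gK // in_itv /= lexx ltW.
- by rewrite gK // in_itv /= lexx ltW.
- by apply: (segment_can_le_continuous (ltW ab)) gK; exact: continuous_subspaceT.
move=> v /andP[fav vfb].
have [/andP[ga gb] fgv] : a <= g v <= b /\ f (g v) = v by apply: gE; rewrite !ltW.
have gab : a < g v < b.
  rewrite !lt_neqAle ga gb !andbT; apply/andP; split.
    by apply: contraTneq fav => ->; rewrite fgv ltxx.
  by apply: contraTneq vfb => <-; rewrite fgv ltxx.
split=> //; rewrite -{1}fgv; apply: (@is_derive_inverse _ f g (df (g v)) (g v)).
- have : \forall z \near g v, z \in `]a, b[ by apply: near_in_itvoo; rewrite in_itv.
  by apply: filterS => z zab; apply: gK; apply: subset_itv_oo_cc.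
- by near=> z; exact: cf.
- by rewrite gt_eqF // df0.
Unshelve. all: by end_near.
Qed.

Lemma der_add f g t d e : is_derive t 1 f d -> is_derive t 1 g e ->
  is_derive t 1 (fun u => f u + g u) (d + e).
Proof. exact: is_deriveD. Qed.

Lemma der_opp f t d : is_derive t 1 f d -> is_derive t 1 (fun u => - f u) (- d).
Proof. exact: is_deriveN. Qed.

Lemma der_sub f g t d e : is_derive t 1 f d -> is_derive t 1 g e ->
  is_derive t 1 (fun u => f u - g u) (d - e).
Proof. exact: is_deriveB. Qed.

Lemma der_mul f g t d e : is_derive t 1 f d -> is_derive t 1 g e ->
  is_derive t 1 (fun u => f u * g u) (d * g t + f t * e).
Proof.
by move=> fd gd; apply: is_derive_eq (is_deriveM fd gd) _; rewrite /GRing.scale /= addrC mulrC.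
Qed.

Lemma der_exp_fun f t d n : is_derive t 1 f d ->
  is_derive t 1 (fun u => f u ^+ n) (n%:R * f t ^+ n.-1 * d).
Proof.
move=> fd; have -> : (fun u => f u ^+ n) = f ^+ n by apply/funext => u; rewrite exprfctE.
exact: is_deriveX.
Qed.

Lemma der_comp f g t d e : is_derive (g t) 1 f d -> is_derive t 1 g e ->
  is_derive t 1 (fun u => f (g u)) (d * e).
Proof. exact: is_derive1_comp. Qed.

Lemma der_id t : is_derive t 1 (fun u : R => u) 1.
Proof. exact: is_derive_id. Qed.

Lemma der_cst (c t : R) : is_derive t 1 (fun _ : R => c) 0.
Proof. exact: is_derive_cst. Qed.

Lemma within_continuousB (A : set R) f g : {within A, continuous f} ->
  {within A, continuous g} -> {within A, continuous (fun u => f u - g u)}.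
Proof. by move=> cf cg x; apply: continuousB; [exact: cf|exact: cg]. Qed.

Lemma within_continuousX (A : set R) f n : {within A, continuous f} ->
  {within A, continuous (fun u => f u ^+ n)}.
Proof.
move=> cf x; apply: (@continuous_comp (subspace A) R R f (fun u => u ^+ n) x); first exact: cf.
exact: exprn_continuous.
Qed.

Lemma derive_within_continuous f df a b :
  (forall t, a <= t <= b -> is_derive t 1 f (df t)) -> {within `[a, b], continuous f}.
Proof.
move=> fd; apply: continuous_in_subspaceT => t; rewrite inE /= in_itv /= => tab.
exact: is_derive_continuous (fd _ tab).
Qed.

End Calculus.

(** * Comparison of the two half orbits *)

Section Comparison.
Variables (R : realType) (n : nat) (M C delta a b : R) (E r1 r2 d1 d2 : R -> R).
Hypotheses (n_gt0 : (0 < n)%N) (M_gt0 : 0 < M) (C_ge0 : 0 <= C).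
Hypotheses (a_lt0 : a < 0) (a_lt_b : a < b).
Hypothesis E0 : E 0 = 0.
Hypothesis E_homo : forall r s, 0 <= r -> r <= s -> s <= delta -> E r <= E s.
Hypothesis E_lip : forall r s, 0 <= r -> r <= s -> s <= delta ->
  E s - E r <= C * (s ^+ n - r ^+ n).
Hypothesis r1_cont : {within `[a, b], continuous r1}.
Hypothesis r2_cont : {within `[a, b], continuous r2}.
Hypotheses (r1a : r1 a = 0) (r1b : r1 b = 0) (r2b : r2 b = 0).
Hypothesis r1_bnd : forall v, a < v < b -> 0 < r1 v < delta.
Hypothesis r2_bnd : forall v, a < v < b -> 0 < r2 v < delta.
Hypothesis r1_der : forall v, a < v < b -> is_derive v 1 (fun u => r1 u ^+ (2 * n)) (d1 v).
Hypothesis r2_der : forall v, a < v < b -> is_derive v 1 (fun u => r2 u ^+ (2 * n)) (d2 v).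
Hypothesis d1_lt : forall v, a < v < b -> d1 v < M * (E (r1 v) - v).
Hypothesis d2_gt : forall v, a < v < b -> M * (E (r2 v) - v) < d2 v.

Let z1 u := r1 u ^+ (2 * n).
Let z2 u := r2 u ^+ (2 * n).

Let n2_gt0 : (0 < 2 * n)%N. Proof. by rewrite muln_gt0. Qed.

(** Otherwise [z2 - z1] has a nonnegative maximum at some [c < b]. There [r1 <= r2], so by
    monotonicity of [E] its derivative is positive, and it exceeds its maximum just to the right. *)
Lemma comparison_below v : a < v < b -> r2 v < r1 v.
Proof.
move=> /andP[av vb]; rewrite ltNge; apply/negP => r12.
pose w u := z2 u - z1 u.
have w_cont : {within `[v, b], continuous w}.
  have sub : `[v, b] `<=` `[a, b] by apply: subset_itvr; rewrite bnd_simp ltW.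
  apply: (continuous_subspaceW sub) ; apply: within_continuousB; exact: within_continuousX.
have wv : 0 <= w v.
  by rewrite subr_ge0 /z1 /z2 lerXn2r // nnegrE ltW //;
    [have /andP[] := r1_bnd (introT andP (conj av vb))|have /andP[] := r2_bnd (introT andP (conj av vb))].
have wb : w b = 0 by rewrite /w /z1 /z2 r1b r2b subrr.
have [c [vc cb wc cmax]] : exists c, [/\ v <= c, c < b, 0 <= w c &
    forall t, v <= t <= b -> w t <= w c].
  have [c] := EVT_max (ltW vb) w_cont; rewrite in_itv /= => /andP[vc cb] cmax.
  have cmax' t : v <= t <= b -> w t <= w c by move=> vtb; apply: cmax; rewrite in_itv.
  have [cE|cb'] := eqVneq c b; last first.
    exists c; split=> //; first by rewrite lt_neqAle cb' cb.
    by apply: le_trans wv _; apply: cmax'; rewrite lexx ltW.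
  (* If the maximum is attained at [b], it is 0 and is attained at [v] as well. *)
  exists v; split=> // t vtb; apply: le_trans (cmax' _ vtb) _.
  by rewrite cE wb.
have acb : a < c < b by rewrite (lt_le_trans av vc).
have /andP[r1c r1d] := r1_bnd acb; have /andP[r2c r2d] := r2_bnd acb.
have r12c : r1 c <= r2 c.
  by move: wc; rewrite subr_ge0 /z1 /z2 ler_pXn2r // nnegrE ltW.
have dw : is_derive c 1 w (d2 c - d1 c) by apply: is_deriveB; [exact: r2_der|exact: r1_der].
have dw0 : 0 < d2 c - d1 c.
  rewrite subr_gt0; apply: lt_trans (d1_lt acb) _; apply: le_lt_trans (d2_gt acb).
  by rewrite ler_pM2l // lerD2r E_homo // ltW.
have [e e0 we] := derive_pos_local dw dw0.
pose s := Num.min (c + e) b.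
have cs : c < s by rewrite lt_min cb ltrDl e0.
have [] := we s; first by rewrite cs ge_min lexx.
move=> wlt _; have : w s <= w c.
  by apply: cmax; rewrite (le_trans vc (ltW cs)) ge_min lexx orbT.
by rewrite leNgt wlt.
Qed.

(* In the variable [tau] with [v = a + tau^2], Gronwall's inequality applies to [z1 - z2]
   although [E] is only Lipschitz in the square root of [z]. *)
Lemma comparison_contradiction : False.
Proof.
pose c := Num.min ((a + b) / 2) (a / 2).
have [ab_ a0_] := (a_lt_b, a_lt0).
have ac : a < c by rewrite lt_min; apply/andP; split; lra.
have cb : c < b by rewrite gt_min; apply/orP; left; lra.
have ca2 : c <= a / 2 by rewrite ge_min lexx orbT.
(* On [[a, c]] one has [- v >= - a / 2], and [E(r2) >= E(0) = 0], so [z2] has slope at least [q]. *)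
pose q := M * (- a / 2); have q0 : 0 < q by rewrite mulr_gt0 // divr_gt0 // oppr_gt0.
have acb v : a < v -> v <= c -> a < v < b by move=> -> /= vc; apply: le_lt_trans vc cb.
have z2_ge v : a < v -> v <= c -> q * (v - a) <= z2 v.
  move=> av vc; rewrite -subr_le0.
  have : q * (v - a) - z2 v <= q * (a - a) - z2 a.
    apply: (@nonincreasing_derive R (fun u => q * (u - a) - z2 u) (fun u => q - d2 u) a v (ltW av)).
    - have sub : `[a, v] `<=` `[a, b] by apply: subset_itvl; rewrite bnd_simp ltW // (le_lt_trans vc).
      apply: within_continuousB; last by apply: (continuous_subspaceW sub); exact: within_continuousX.
      by apply: (@derive_within_continuous _ _ (fun u => 0 * (u - a) + q * (1 - 0))) => u _;
        apply: der_mul (der_cst _ _) (der_sub (der_id _) (der_cst _ _)).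
    - move=> u /andP[au uv]; apply: der_sub; last by apply: r2_der; apply: acb => //; apply: le_trans (ltW uv) vc.
      apply: is_derive_eq (der_mul (der_cst q u) (der_sub (der_id u) (der_cst a u))) _.
      by rewrite mul0r add0r subr0 mulr1.
    - move=> u /andP[au uv]; have ub := acb _ au (le_trans (ltW uv) vc).
      have /andP[ru rd] := r2_bnd ub.
      rewrite subr_le0; apply: le_trans (ltW (d2_gt ub)); rewrite ler_pM2l //.
      have := E_homo (lexx 0) (ltW ru) (ltW rd); rewrite E0.
      by have := le_trans (ltW uv) (le_trans vc ca2); lra.
  by rewrite subrr mulr0 sub0r => /le_trans; apply; rewrite oppr_le0 /z2 mulnC exprM sqr_ge0.
pose kappa := Num.sqrt q; have kappa0 : 0 < kappa by rewrite sqrtr_gt0.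
(* [z1 - z2] factors as [(r1^n - r2^n) (r1^n + r2^n)], whose second factor is at least
   [kappa * tau]. This cancels the [2 * tau] in [d/dtau = 2 tau d/dv] and leaves the rate [K]. *)
pose K := 2 * M * C / kappa.
pose h t := (z1 (a + t ^+ 2) - z2 (a + t ^+ 2)) * expR (- K * t).
pose t1 := Num.sqrt (c - a).
have t10 : 0 < t1 by rewrite sqrtr_gt0 subr_gt0.
have t1E : a + t1 ^+ 2 = c by rewrite sqr_sqrtr ?subr_ge0 ?(ltW ac) // addrC subrK.
have key u : a < u -> u <= c -> 0 < z1 u - z2 u /\
    (d1 u - d2 u) * (kappa * Num.sqrt (u - a)) <= M * C * (z1 u - z2 u).
  move=> au uc; have ub := acb _ au uc.
  have /andP[r10 r1d] := r1_bnd ub; have /andP[r20 r2d] := r2_bnd ub.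
  have r21 := comparison_below ub.
  have zE (r : R -> R) : r u ^+ (2 * n) = (r u ^+ n) ^+ 2 by rewrite mulnC exprM.
  have rn : r2 u ^+ n < r1 u ^+ n by rewrite ltrXn2r ?nnegrE ?ltW // -lt0n.
  have r2n : kappa * Num.sqrt (u - a) <= r2 u ^+ n.
    have := ler_wsqrtr (z2_ge _ au uc).
    by rewrite sqrtrM ?(ltW q0) // /z2 zE sqrtr_sqr ger0_norm // exprn_ge0 // ltW.
  have r2n0 : 0 <= r2 u ^+ n by rewrite exprn_ge0 ?ltW.
  rewrite /z1 /z2 !zE subr_sqr; split; first by rewrite mulr_gt0 ?subr_gt0 // ltr_wpDr // exprn_gt0.
  have dd : d1 u - d2 u <= M * C * (r1 u ^+ n - r2 u ^+ n).
    have e1 := d1_lt ub; have e2 := d2_gt ub.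
    have e3 := E_lip (ltW r20) (ltW r21) (ltW r1d).
    have : M * (E (r1 u) - E (r2 u)) <= M * (C * (r1 u ^+ n - r2 u ^+ n)) by rewrite ler_pM2l.
    by lra.
  have ks0 : 0 <= kappa * Num.sqrt (u - a) by rewrite mulr_ge0 ?sqrtr_ge0 ?ltW.
  have MC0 : 0 <= M * C by rewrite mulr_ge0 // ltW.
  apply: le_trans (ler_wpM2r ks0 dd) _; rewrite -!(mulrA (M * C)) ler_wpM2l //.
  rewrite ler_wpM2l // ?subr_ge0 ?(ltW rn) //.
  by apply: le_trans r2n _; rewrite lerDr (le_trans r2n0) // ltW.
have h_noninc t0 : 0 < t0 -> t0 <= t1 -> h t1 <= h t0.
  move=> t00 t01.
  have inab t : t0 <= t <= t1 -> a < a + t ^+ 2 /\ a + t ^+ 2 <= c.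
    move=> /andP[tt0 tt1]; rewrite ltrDl exprn_gt0 ?(lt_le_trans t00) // -t1E lerD2l.
    by rewrite lerXn2r // nnegrE ?ltW // (lt_le_trans t00).
  pose dh t := ((d1 (a + t ^+ 2) - d2 (a + t ^+ 2)) * (0 + 2%:R * t ^+ 1 * 1)) * expR (- K * t)
     + (z1 (a + t ^+ 2) - z2 (a + t ^+ 2)) * (expR (- K * t) * (0 * t + - K * 1)).
  have hd t : t0 <= t <= t1 -> is_derive t 1 h (dh t).
    move=> /inab[at_ tc]; have tb := acb _ at_ tc.
    apply: der_mul; last first.
      by apply: der_comp (is_derive_expR _) (der_mul (der_cst _ _) (der_id _)).
    apply: (@der_comp _ (fun u => z1 u - z2 u) (fun u => a + u ^+ 2)).
      by apply: der_sub; [exact: r1_der|exact: r2_der].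
    exact: der_add (der_cst _ _) (der_exp_fun 2 (der_id _)).
  apply: (@nonincreasing_derive R h dh t0 t1 t01).
  - exact: derive_within_continuous hd.
  - by move=> t /andP[tt0 tt1]; apply: hd; rewrite !ltW.
  move=> t /andP[tt0 tt1].
  have [at_ tc] : a < a + t ^+ 2 /\ a + t ^+ 2 <= c by apply: inab; rewrite !ltW.
  have [zz ineq] := key _ at_ tc; rewrite /dh.
  set D := d1 _ - d2 _ in ineq *; set Z := z1 _ - z2 _ in zz ineq *.
  have -> : D * (0 + 2%:R * t ^+ 1 * 1) * expR (- K * t) + Z * (expR (- K * t) * (0 * t + - K * 1))
     = expR (- K * t) * (2 * (D * t - (M * C * Z) / kappa)) by rewrite /K; field; rewrite gt_eqF.
  rewrite mulr_ge0_le0 ?expR_ge0 // mulr_ge0_le0 // subr_le0 ler_pdivlMr //.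
  apply: le_trans ineq; rewrite [a + _]addrC addrK sqrtr_sqr gtr0_norm ?(lt_trans t00) //.
  by rewrite -mulrA [t * _]mulrC.
have h1 : 0 < h t1.
  by rewrite mulr_gt0 ?expR_gt0 // t1E; have [] := key c ac (lexx c).
have z1_cont : {within `[a, b], continuous z1} by exact: within_continuousX.
have [_ z1_right _] := (continuous_within_itvP z1 a_lt_b).1 z1_cont.
have z1a : z1 a = 0 by rewrite /z1 r1a expr0n gtn_eqF.
(* [h] is at most [z1], which tends to 0 at [a], so [h] is smaller near [a] than at [t1], against
   its monotonicity. *)
have [y [ya yc zy]] : exists y, [/\ a < y, y < c & z1 y < h t1].
  near a^'+ => y; exists y; split; near: y.
  - exact: nbhs_right_gt.
  - exact: nbhs_right_lt.
  - by have /cvgr_lt := z1_right; apply; rewrite z1a.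
pose t0 := Num.sqrt (y - a).
have t00 : 0 < t0 by rewrite sqrtr_gt0 subr_gt0.
have t01 : t0 <= t1 by rewrite ler_wsqrtr // lerD2r ltW.
have t0E : a + t0 ^+ 2 = y by rewrite sqr_sqrtr ?subr_ge0 ?(ltW ya) // addrC subrK.
have := h_noninc t0 t00 t01; rewrite leNgt => /negP; apply.
apply: le_lt_trans zy; rewrite /h t0E.
have [zz _] := key y ya (ltW yc).
have z20 : 0 <= z2 y by rewrite /z2 mulnC exprM sqr_ge0.
apply: le_trans (_ : z1 y - z2 y <= _); last by rewrite gerBl.
rewrite ler_piMr ?(ltW zz) // -expR0 ler_expR mulNr oppr_le0 mulr_ge0 ?(ltW t00) //.
by rewrite divr_ge0 ?(ltW kappa0) // !mulr_ge0 // ltW.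
Unshelve. all: by end_near.
Qed.
End Comparison.

(** * Orbits near the origin *)

Section Flow.
Variable R : realType.
Implicit Types (f B p u E : {poly R}) (x y : R -> R).

Lemma horner_bounded p : exists2 C, 0 <= C & forall a, `|a| <= 1 -> `|p.[a]| <= C.
Proof.
elim/poly_ind: p => [|p c [C C0 IH]]; first by exists 0 => // a _; rewrite horner0 normr0.
exists (C + `|c|) => [|a a1]; first by rewrite addr_ge0.
rewrite hornerMXaddC (le_trans (ler_normD _ _)) // lerD2r normrM.
by rewrite -[C]mulr1 ler_pM ?IH.
Qed.

Lemma horner_bigO k p : 'X^k %| p ->
  exists2 C, 0 <= C & forall a, `|a| <= 1 -> `|p.[a]| <= C * `|a| ^+ k.
Proof.
move=> /dvdpP [q ->]; have [C C0 qC] := horner_bounded q.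
exists C => // a a1; rewrite hornerM hornerXn normrM normrX ler_wpM2r ?exprn_ge0 //.
exact: qC.
Qed.

Lemma horner_near1 p : p`_0 = 1 ->
  exists2 d, 0 < d <= 1 & forall a, `|a| <= d -> 2^-1 <= p.[a] <= 2.
Proof.
move=> p0; have [|C C0 pC] := @horner_bigO 1 (p - 1).
  by rewrite expr1 -['X]subr0 -polyC0 dvdp_XsubCl /root hornerD hornerN hornerC horner_coef0 p0 subrr.
have d0 : 0 < (2 * (C + 1))^-1 by rewrite invr_gt0 mulr_gt0 // ltr_wpDl.
have d1 : (2 * (C + 1))^-1 <= 1 by rewrite invf_le1 ?mulr_gt0 ?ltr_wpDl //; lra.
exists (2 * (C + 1))^-1 => [|a ad]; first by rewrite d0 d1.
have := pC a (le_trans ad d1); rewrite expr1 hornerD hornerN hornerC => pa.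
have : C * `|a| <= 2^-1.
  apply: le_trans (ler_wpM2l C0 ad) _.
  rewrite invfM mulrCA ler_piMr ?invr_ge0 // ler_pdivrMr ?mul1r ?ltr_wpDl //; lra.
move=> /(le_trans pa); rewrite ler_norml => /andP[]; lra.
Qed.

Variable n : nat.
Hypothesis n_gt0 : (0 < n)%N.

Definition solves f B x y : Prop := forall t : R,
  is_derive t 1 x (- y t * f.[x t] + B.[x t]) /\ is_derive t 1 y (x t ^+ (2 * n - 1)).

(** The half-turn about the origin, which makes left half orbits into right ones. *)
Lemma solves_refl f B x y : solves f B x y ->
  solves (f \Po (- 'X)) (- (B \Po (- 'X))) (fun t => - x t) (fun t => - y t).
Proof.
move=> sol t; have [xd yd] := sol t; split.
  apply: is_derive_eq (der_opp xd) _.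
  by rewrite hornerN !horner_comp !hornerE !opprK; ring.
apply: is_derive_eq (der_opp yd) _.
by rewrite exprNn -signr_odd (_ : odd (2 * n - 1)) ?expr1 ?mulN1r //; move: n_gt0; clear; lia.
Qed.

(** Time reversal combined with reflection in the [x]-axis keeps [f] and negates [B]. *)
Lemma solves_rev f B x y : solves f B x y ->
  solves f (- B) (fun t => x (- t)) (fun t => - y (- t)).
Proof.
move=> sol t; have [xd yd] := sol (- t); have idN := der_opp (der_id t).
split.
  by apply: is_derive_eq (der_comp xd idN) _; rewrite hornerN; ring.
by apply: is_derive_eq (der_opp (der_comp yd idN)) _; rewrite mulrN1 opprK.
Qed.

Lemma solves_continuous f B x y : solves f B x y -> continuous x /\ continuous y.
Proof.
by move=> sol; split=> t; have [xd yd] := sol t; [exact: is_derive_continuous xd|exact: is_derive_continuous yd].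
Qed.

(** On the [y]-axis [x' = - y]: the orbit enters the right half-plane at [ta], and periodicity
    brings it back within time [T]. If it returned at negative [y], then [x] would be negative just
    before. *)
Lemma excursion f B x y T ta : f`_0 = 1 -> B`_0 = 0 -> solves f B x y -> 0 < T ->
  (forall t, x (t + T) = x t) -> (forall t, (x t, y t) <> (0, 0)) ->
  x ta = 0 -> y ta < 0 ->
  exists tb, [/\ ta < tb <= ta + T, x tb = 0, 0 < y tb & forall t, ta < t < tb -> 0 < x t].
Proof.
move=> f0 B0 sol T0 xT nz xa ya; have [xc yc] := solves_continuous sol.
have dx t : x t = 0 -> is_derive t 1 x (- y t).
  move=> xt; have [xd _] := sol t; apply: is_derive_eq xd _.
  by rewrite xt !horner_coef0 f0 B0 mulr1 addr0.
have [|e e0 xe] := derive_pos_local (dx _ xa); first by rewrite oppr_gt0.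
pose a := ta + Num.min e (T / 2).
have ea : 0 < Num.min e (T / 2) by rewrite lt_min e0 divr_gt0.
have aT : a <= ta + T by rewrite lerD2l ge_min; apply/orP; right; lra.
have early t : ta < t <= a -> 0 < x t.
  move=> /andP[tt ta_]; have [|+ _] := xe t; last by rewrite xa.
  by rewrite tt (le_trans ta_) // lerD2l ge_min lexx.
have xcN : continuous (fun t => - x t) by move=> t; apply: continuousN; exact: xc.
have [||tb [/andP[atb tbT] xtb before]] := @first_hitting R (fun t => - x t) a (ta + T) 0 aT xcN.
- by rewrite oppr_lt0 early // lexx andbT ltrDl.
- by rewrite xT xa oppr0.
have tab : ta < tb by apply: lt_trans atb; rewrite ltrDl.
have {}xtb : x tb = 0 by apply/eqP; rewrite -oppr_eq0 xtb.
have pos t : ta < t < tb -> 0 < x t.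
  move=> /andP[tt ttb]; have [ta_|at_] := leP t a; first by rewrite early // tt.
  by rewrite -oppr_lt0 before // (ltW at_).
exists tb; split=> //; first by rewrite tab.
have yn0 : y tb != 0 by apply/eqP => y0; apply: (nz tb); rewrite xtb y0.
rewrite lt_neqAle eq_sym yn0 leNgt; apply/negP => y0.
have [|e' e'0 xe'] := derive_pos_local (dx _ xtb); first by rewrite oppr_gt0.
pose s := tb + Num.min e' ((tb - ta) / 2).
have s0 : 0 < Num.min e' ((tb - ta) / 2) by rewrite lt_min e'0 divr_gt0 // subr_gt0.
have [|_] := xe' s; first by rewrite ltrDl s0 lerD2l ge_min lexx.
rewrite xtb ltNge => /negP; apply; apply/ltW/pos.
have -> : s - tb = Num.min e' ((tb - ta) / 2) by rewrite /s addrC addKr.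
rewrite gtrBl s0 andbT ltrBrDl -ltrBrDr.
by rewrite gt_min; apply/orP; right; lra.
Qed.

(** [L = n y^2 + x^(2n)] is constant when [f = 1] and [B = 0]. In general, while [0 <= x <= d], the
    derivative of [sqrt L] is at most half that of [y], so [sqrt L - y / 2] does not increase. This
    bounds [L] without a bound on the time spent. *)
Lemma confinement f B delta : f`_0 = 1 -> 'X^(n.+1) %| B -> 0 < delta ->
  exists2 eta, 0 < eta & forall x y ta tb, solves f B x y ->
    (forall t, (x t, y t) <> (0, 0)) -> x ta = 0 -> - eta < y ta < 0 ->
    (forall t, ta < t < tb -> 0 <= x t) -> x tb = 0 ->
    forall t, ta <= t <= tb -> x t < delta /\ `|y t| <= (2 * n + 1)%:R * - y ta.
Proof.
move=> f0 dvB delta0.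
have [|C C0 fC] := @horner_bigO 1 (1 - f).
  by rewrite expr1 -['X]subr0 -polyC0 dvdp_XsubCl /root hornerD hornerN hornerC horner_coef0 f0 subrr.
have [C' C'0 BC] := horner_bigO dvB.
pose nR : R := n%:R; have nR1 : 1 <= nR by rewrite ler1n.
(* Chosen so that [2n x^(2n-1) (2 kap sqrt L) / (2 sqrt L)] is [x^(2n-1) / 2], half the speed of
   [y]. *)
pose kap := (4 * nR)^-1.
have kap0 : 0 < kap by rewrite invr_gt0; lra.
pose d := Num.min (Num.min delta 1) (kap / (C + C' + 1)).
have CC1 : 0 < C + C' + 1 by lra.
have d0 : 0 < d by rewrite !lt_min delta0 ltr01 divr_gt0.
have d_delta : d <= delta by rewrite !ge_min lexx.
have d1 : d <= 1 by rewrite !ge_min lexx orbT.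
have dk : (C + C' + 1) * d <= kap.
  by rewrite mulrC -ler_pdivlMr // ge_min lexx orbT.
have fk a : 0 <= a <= d -> `|1 - f.[a]| <= kap /\ `|B.[a]| <= kap * a ^+ n.
  move=> /andP[a0 ad]; have a1 : `|a| <= 1 by rewrite ger0_norm // (le_trans ad).
  have := fC a a1; have := BC a a1; rewrite hornerD hornerN hornerC [`|a|]ger0_norm // expr1 exprS => Ba fa.
  have an0 : 0 <= a ^+ n by rewrite exprn_ge0.
  have Cad : C * a <= kap.
    apply: le_trans dk; apply: le_trans (ler_wpM2l C0 ad) _.
    by rewrite ler_wpM2r ?(ltW d0) //; lra.
  have C'ad : C' * a <= kap.
    apply: le_trans dk; apply: le_trans (ler_wpM2l C'0 ad) _.
    by rewrite ler_wpM2r ?(ltW d0) //; lra.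
  split; first exact: le_trans fa Cad.
  by apply: le_trans Ba _; rewrite mulrA ler_wpM2r.
pose K : R := (2 * n + 1)%:R.
have KE : K = 2 * nR + 1 by rewrite /K natrD natrM.
have K0 : 0 < K by rewrite KE; lra.
(* [K = 2n + 1] comes from [sqrt L <= n |y ta| + (sqrt L + |y ta|) / 2]; then
   [x^n <= sqrt L <= K |y ta| < d^n] keeps [x] below [d]. *)
exists (d ^+ n / K); first by rewrite divr_gt0 ?exprn_gt0.
move=> x y ta tb sol nz xa /andP[ya_eta ya0] xpos xb.
have [xc yc] := solves_continuous sol.
pose L t := nR * y t ^+ 2 + x t ^+ (2 * n).
have x2n t : x t ^+ (2 * n) = (x t ^+ n) ^+ 2 by rewrite mulnC exprM.
have L0 t : 0 < L t.
  have y20 := sqr_ge0 (y t); have xn0 := sqr_ge0 (x t ^+ n).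
  have [y0|yn0] := eqVneq (y t) 0; last first.
    have y2 : 0 < y t ^+ 2 by rewrite exprn_even_gt0.
    by rewrite /L x2n ltr_wpDr // mulr_gt0 // (lt_le_trans ltr01).
  have xn : x t != 0 by apply/eqP => x0; apply: (nz t); rewrite x0 y0.
  by rewrite /L y0 expr0n /= mulr0 add0r x2n exprn_even_gt0 // expf_neq0.
have yL t : `|y t| <= Num.sqrt (L t).
  rewrite -sqrtr_sqr ler_wsqrtr //.
  have := sqr_ge0 (y t); have := sqr_ge0 (x t ^+ n); rewrite /L x2n.
  have : 0 <= (nR - 1) * y t ^+ 2 by rewrite mulr_ge0 ?sqr_ge0 ?subr_ge0.
  by lra.
have xL t : x t ^+ n <= Num.sqrt (L t).
  apply: le_trans (ler_norm _) _; rewrite -sqrtr_sqr ler_wsqrtr // /L x2n lerDr.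
  by rewrite mulr_ge0 ?sqr_ge0 // (le_trans ler01).
have bound t : ta <= t -> (forall s, ta < s < t -> 0 <= x s <= d) -> Num.sqrt (L t) <= K * - y ta.
  move=> tat small.
  pose phi s := Num.sqrt (L s) - y s * 2^-1.
  pose dL s := 2 * nR * x s ^+ (2 * n - 1) * (y s * (1 - f.[x s]) + B.[x s]).
  pose dphi s := (2 * Num.sqrt (L s))^-1 * dL s - (x s ^+ (2 * n - 1) * 2^-1 + y s * 0).
  have Ld (s : R) : is_derive s 1 L (dL s).
    have [xd yd] := sol s.
    apply: is_derive_eq (der_add (der_mul (der_cst nR s) (der_exp_fun 2 yd)) (der_exp_fun (2 * n) xd)) _.
    rewrite /dL natrM -(subn1 (2 * n)) -[2.-1]/1%N expr1 -/nR; move: (x s ^+ _) => X1; ring.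
  have phid (s : R) : is_derive s 1 phi (dphi s).
    have [xd yd] := sol s.
    apply: der_sub; last exact: der_mul yd (der_cst _ _).
    exact: der_comp (is_derive1_sqrt (L0 s)) (Ld s).
  have : phi t <= phi ta.
    apply: (@nonincreasing_derive R phi dphi ta t tat) => [|s tas].
      by apply: derive_within_continuous => s _.
    have /andP[xs0 xsd] := small s tas; have [|f1 B1] := fk (x s); first by rewrite xs0.
    have S0 : 0 < Num.sqrt (L s) by rewrite sqrtr_gt0.
    have xp0 : 0 <= x s ^+ (2 * n - 1) by rewrite exprn_ge0.
    rewrite /dphi mulr0 addr0 subr_le0 /dL.
    have ineq : y s * (1 - f.[x s]) + B.[x s] <= 2 * kap * Num.sqrt (L s).
      apply: le_trans (ler_norm _) _; apply: le_trans (ler_normD _ _) _; rewrite normrM.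
      have e1 : `|y s| * `|1 - f.[x s]| <= Num.sqrt (L s) * kap by rewrite ler_pM // yL.
      have e2 : kap * x s ^+ n <= kap * Num.sqrt (L s) by rewrite ler_wpM2l ?(ltW kap0) ?xL.
      by have := le_trans B1 e2; lra.
    have kE : 4 * nR * kap = 1 by rewrite mulfV //; apply: lt0r_neq0; lra.
    rewrite mulrC ler_pdivrMr ?mulr_gt0 //.
    have -> : x s ^+ (2 * n - 1) * 2^-1 * (2 * Num.sqrt (L s)) =
        2 * nR * x s ^+ (2 * n - 1) * (2 * kap * Num.sqrt (L s)).
      have -> : 2 * nR * x s ^+ (2 * n - 1) * (2 * kap * Num.sqrt (L s)) =
        (4 * nR * kap) * x s ^+ (2 * n - 1) * Num.sqrt (L s) by ring.
      by rewrite kE; field.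
    by rewrite ler_wpM2l // mulr_ge0 //; lra.
  rewrite /phi; have La : Num.sqrt (L ta) <= nR * - y ta.
    rewrite -[leRHS]ger0_norm; last by rewrite mulr_ge0 //; lra.
    rewrite -sqrtr_sqr ler_wsqrtr // /L xa expr0n muln_eq0 /= eqn0Ngt n_gt0 addr0 exprMn sqrrN.
    by rewrite ler_wpM2r ?sqr_ge0 // expr2 ler_peMl //; lra.
  have := ler_norm (y t); have := yL t; rewrite KE; lra.
have xd t : ta <= t <= tb -> 0 <= x t < d.
  move=> /andP[tat ttb]; apply/andP; split.
    move: tat ttb; rewrite (le_eqVlt ta) (le_eqVlt t) => /predU1P[<-|tat] /predU1P[ttb|ttb].
    - by rewrite xa.
    - by rewrite xa.
    - by rewrite ttb xb.
    - by rewrite xpos // tat.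
  rewrite ltNge; apply/negP => dx.
  have [|s [/andP[tas st] xs before]] := @first_hitting R x ta t d tat xc _ dx; first by rewrite xa.
  have : Num.sqrt (L s) <= K * - y ta.
    apply: bound (ltW tas) _ => u /andP[tau us]; apply/andP; split.
      by apply: xpos; rewrite tau (lt_le_trans us) // (le_trans st).
    by apply/ltW/before; rewrite (ltW tau).
  move=> /(le_trans (xL s)); rewrite xs leNgt => /negP; apply.
  by rewrite -ltr_pdivlMl // mulrC; lra.
move=> t tatb; have /andP[tat ttb] := tatb; split.
  by have /andP[_ xtd] := xd t tatb; exact: lt_le_trans xtd d_delta.
apply: le_trans (yL t) _; apply: bound => // s /andP[tas st].
have /andP[xs0 xsd] : 0 <= x s < d by apply: xd; rewrite (ltW tas) (le_trans (ltW st)).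
by rewrite xs0 ltW.
Qed.
End Flow.

(** * The right half orbit as a graph over the [y]-axis *)

Section HalfReturn.
Variables (R : realType) (n : nat).
Hypothesis n_gt0 : (0 < n)%N.
Implicit Types (f B p u E : {poly R}) (x y : R -> R).

(* In the coordinates [z = u(x)^(2n)] and [y], the half orbit is the graph of a function [z] of [y]
   with [dz/dy] close to [2n (E(u) + c u^k - y)]. *)
Lemma half_return f B u E c k epsilon :
  f`_0 = 1 -> u`_0 = 0 -> u`_1 = 1 ->
  eqmodX (2 * n + k) (u^`() * u ^+ (2 * n - 1) * f) 'X^(2 * n - 1) ->
  eqmodX k.+1 B (f * (E \Po u + c *: u ^+ k)) ->
  c < 0 -> 0 < epsilon ->
  exists2 delta, 0 < delta & forall x y ta tb, solves n f B x y -> ta < tb ->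
    x ta = 0 -> x tb = 0 ->
    (forall t, ta < t < tb -> 0 < x t < delta /\ `|y t| <= 1) ->
    y ta < y tb /\ exists r d : R -> R,
      [/\ {within `[y ta, y tb], continuous r}, r (y ta) = 0, r (y tb) = 0 &
        forall v, y ta < v < y tb -> [/\ 0 < r v < epsilon,
          is_derive v 1 (fun w => r w ^+ (2 * n)) (d v) &
          d v < (2 * n)%:R * (E.[r v] - v)]].
Proof.
move=> f0 u0 u1 /dvdpP [q qE] /dvdpP [s sE] c0 eps0.
have [w uE] : exists w, u = w * 'X.
  by have /factor_theorem [w uw] : root u 0; [rewrite /root horner_coef0 u0|exists w; rewrite uw subr0].
have w0 : w`_0 = 1 by rewrite -u1 uE coefMX.
have [df /andP[df0 df1] fb] := horner_near1 f0.
have [dw /andP[dw0 dw1] wb] := horner_near1 w0.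
have [Cq Cq0 qb] := horner_bounded q.
have [Cs Cs0 sb] := horner_bounded s.
have [CG CG0 Gb] := horner_bounded (E \Po u + c *: u ^+ k).
(* Bounds the remainder, of order [x^(k+1)], in the slope of [z]; the factor 2 comes from
   [f >= 1/2]. *)
pose C := Cq * (CG + 1) + (1 + Cq) * (Cs * 2).
have C0 : 0 <= C by rewrite /C !(addr_ge0, mulr_ge0).
(* Since [u >= x / 2], the term [c u^k] is at most [- m x^k], which dominates the remainder when
   [(C + 1) delta <= m]. *)
pose m := - c / 2 ^+ k.
have m0 : 0 < m by apply: divr_gt0; [rewrite oppr_gt0|rewrite exprn_gt0].
pose delta := Num.min (Num.min df dw) (Num.min (epsilon / 2) (m / (C + 1))).
have C1 : 0 < C + 1 by rewrite ltr_wpDl.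
have eps2 : 0 < epsilon / 2 by exact: divr_gt0.
have mC : 0 < m / (C + 1) by exact: divr_gt0.
have delta0 : 0 < delta by rewrite !lt_min df0 dw0 eps2 mC.
have d_df : delta <= df by rewrite !ge_min lexx.
have d_dw : delta <= dw by rewrite !ge_min lexx orbT.
have d_eps : delta <= epsilon / 2 by rewrite !ge_min lexx !orbT.
have d_m : (C + 1) * delta <= m by rewrite mulrC -ler_pdivlMr // !ge_min lexx !orbT.
exists delta => // x y ta tb sol tab xa xb bnd.
have [xc yc] := solves_continuous sol.
have yd t : is_derive (t : R) 1 y (x t ^+ (2 * n - 1)) by have [] := sol t.
have ypos t : ta < t < tb -> 0 < x t ^+ (2 * n - 1).
  by move=> /bnd[/andP[x0 _] _]; rewrite exprn_gt0.
have [g [ga gb gc gv]] := inverse_increasing tab yd ypos.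
have yab : y ta < y tb.
  apply: (@increasing_derive R y (fun t => x t ^+ (2 * n - 1)) ta tb tab) => //.
  exact: continuous_subspaceT.
split=> //; pose r v := u.[x (g v)].
pose dr v := u^`().[x (g v)] * ((- y (g v) * f.[x (g v)] + B.[x (g v)]) * (x (g v) ^+ (2 * n - 1))^-1).
exists r, (fun v => (2 * n)%:R * r v ^+ (2 * n).-1 * dr v); split.
- move=> v; apply: (@continuous_comp (subspace `[y ta, y tb]) R R g (fun t => u.[x t]) v).
    exact: gc.
  apply: (@continuous_comp R R R x (horner u)); first exact: xc.
  exact: continuous_horner.
- by rewrite /r ga xa horner_coef0.
- by rewrite /r gb xb horner_coef0.
move=> v vab; have [gab ygv gd] := gv v vab.
have [/andP[x0 xdelta] y1] := bnd _ gab.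
rewrite /r /dr; set a := x (g v) in x0 xdelta *.
have a_ge0 := ltW x0; have a_le : a <= delta by exact: ltW.
have absa : `|a| = a by rewrite ger0_norm.
have a1 : `|a| <= 1 by rewrite absa (le_trans a_le) // (le_trans d_df).
have ua : u.[a] = w.[a] * a by rewrite uE hornerMX.
have /andP[wl wr] : 2^-1 <= w.[a] <= 2 by apply: wb; rewrite absa (le_trans a_le).
have /andP[fl fr] : 2^-1 <= f.[a] <= 2 by apply: fb; rewrite absa (le_trans a_le).
have ul : 2^-1 * a <= u.[a] by rewrite ua ler_wpM2r.
have ur : u.[a] <= 2 * a by rewrite ua ler_wpM2r.
split.
- apply/andP; split; first by apply: lt_le_trans ul; rewrite mulr_gt0.
  by apply: le_lt_trans ur _; lra.
- apply: der_exp_fun; apply: (@der_comp _ (horner u) (fun w => x (g w))).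
  by apply: der_comp gd; have [] := sol (g v).
pose G := (E \Po u + c *: u ^+ k).[a] - v.
pose An := a ^+ (2 * n - 1); pose Ak := a ^+ k.+1.
have An0 : 0 < An by rewrite exprn_gt0.
have Ak0 : 0 < Ak by rewrite exprn_gt0.
have e1 : u^`().[a] * u.[a] ^+ (2 * n - 1) * f.[a] = An * (1 + q.[a] * Ak).
  have := congr1 (fun p : {poly R} => p.[a]) qE.
  rewrite /= !hornerE => /eqP; rewrite subr_eq => /eqP ->.
  have -> : a ^+ (2 * n + k) = An * Ak.
    by rewrite -exprD; congr (_ ^+ _); move: n_gt0; clear; lia.
  by rewrite -/An; ring.
have e2 : - v * f.[a] + B.[a] = f.[a] * G + s.[a] * Ak.
  have := congr1 (fun p : {poly R} => p.[a]) sE.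
  rewrite /= hornerD hornerN hornerM => /eqP; rewrite subr_eq => /eqP ->.
  by rewrite hornerM hornerXn /G -/Ak; ring.
have fa0 : 0 < f.[a] by apply: lt_le_trans fl.
rewrite ygv e2 -(subn1 (2 * n)).
have -> : (2 * n)%:R * u.[a] ^+ (2 * n - 1) * (u^`().[a] * ((f.[a] * G + s.[a] * Ak) / An)) =
  (2 * n)%:R * ((u^`().[a] * u.[a] ^+ (2 * n - 1) * f.[a]) * (G + s.[a] * Ak / f.[a]) / An).
  by field; rewrite (gt_eqF An0) (gt_eqF fa0).
have n2 : 0 < (2 * n)%:R :> R by rewrite ltr0n muln_gt0.
rewrite e1 ltr_pM2l //.
(* The slope of [z], divided by [2n]: besides [E(u) - v] there remain [c u^k] and a term of order
   [x^(k+1)], whose sum is negative. *)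
have -> : An * (1 + q.[a] * Ak) * (G + s.[a] * Ak / f.[a]) / An =
   E.[u.[a]] - v + (c * u.[a] ^+ k + Ak * (q.[a] * G + (1 + q.[a] * Ak) * (s.[a] / f.[a]))).
  rewrite /G hornerD horner_comp hornerZ horner_exp.
  by field; rewrite (gt_eqF An0) (gt_eqF fa0).
rewrite gtrDl.
have low : c * u.[a] ^+ k <= - m * a ^+ k.
  have -> : - m * a ^+ k = c * (2^-1 * a) ^+ k by rewrite /m exprMn exprVn; ring.
  by rewrite ler_wnM2l ?(ltW c0) // lerXn2r // nnegrE ?mulr_ge0 // (le_trans _ ul) // mulr_ge0.
have Ak1 : Ak <= 1 by rewrite exprn_ile1 // -absa.
have G1 : `|G| <= CG + 1.
  apply: le_trans (ler_normB _ _) _; rewrite lerD ?Gb //.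
  by rewrite -ygv.
have rest : q.[a] * G + (1 + q.[a] * Ak) * (s.[a] / f.[a]) <= C.
  apply: le_trans (ler_norm _) _; apply: le_trans (ler_normD _ _) _; rewrite !normrM lerD //.
    by rewrite ler_pM ?qb.
  apply: ler_pM; rewrite ?mulr_ge0 //.
    apply: le_trans (ler_normD _ _) _; rewrite normr1 lerD2l normrM (gtr0_norm Ak0).
    by rewrite -[Cq]mulr1 ler_pM ?qb // ltW.
  rewrite ler_pM ?sb // normfV (gtr0_norm fa0).
  by rewrite -[leRHS]invrK lef_pV2 ?posrE ?invr_gt0.
have up : Ak * (q.[a] * G + (1 + q.[a] * Ak) * (s.[a] / f.[a])) < m * a ^+ k.
  apply: le_lt_trans (ler_wpM2l (ltW Ak0) rest) _.
  rewrite /Ak exprS mulrAC ltr_pM2r ?exprn_gt0 //.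
  apply: lt_le_trans d_m; rewrite mulrC; apply: le_lt_trans (ler_wpM2l C0 a_le) _.
  by rewrite ltr_pM2r // ltrDl.
by lra.
Qed.

End HalfReturn.

(** * Symmetries and the contradiction *)

Section NoCenter.
Variables (R : realType) (n : nat).
Hypothesis n_gt0 : (0 < n)%N.
Implicit Types (f B p u E : {poly R}) (x y : R -> R).

Lemma within_continuous_opp (r : R -> R) (a b : R) : {within `[- b, - a], continuous r} ->
  {within `[a, b], continuous (fun v => r (- v))}.
Proof.
move/subspace_continuousP => rc; apply/subspace_continuousP => v /=.
rewrite in_itv /= => /andP[av vb].
have nvab : [set` `[- b, - a]] (- v) by rewrite /= in_itv /= !lerN2 vb av.
apply: (@cvg_comp _ _ _ (fun w : R => - w) r _ (within [set` `[- b, - a]] (nbhs (- v))));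
  last exact: rc.
move=> S nS; change (nbhs v [set w | [set` `[a, b]] w -> S (- w)]).
have : nbhs v [set w : R | [set` `[- b, - a]] (- w) -> S (- w)] := @opp_continuous R v _ nS.
apply: filterS => w /= Sw wab; apply: Sw.
by move: wab; rewrite /= !in_itv /= !lerN2 andbC.
Qed.

(** The consequence of a center that is refuted; it is preserved by both symmetries. *)
Definition small_orbits f B : Prop :=
  exists2 epsilon : R, 0 < epsilon & forall y0 : R, y0 != 0 -> `|y0| < epsilon ->
    exists (x y : R -> R) (T : R), [/\ solves n f B x y, 0 < T,
      forall t, x (t + T) = x t /\ y (t + T) = y t,
      forall t, (x t, y t) <> (0, 0) & x 0 = 0 /\ y 0 = y0].

Lemma small_orbits_refl f B : small_orbits f B ->
  small_orbits (f \Po (- 'X)) (- (B \Po (- 'X))).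
Proof.
move=> [e e0 orb]; exists e => // y0 y00 y0e.
have [||x [y [T [sol T0 per nz [x00 y0E]]]]] := orb (- y0); rewrite ?oppr_eq0 ?normrN //.
exists (fun t => - x t), (fun t => - y t), T; split => //.
- exact: solves_refl.
- by move=> t; have [-> ->] := per t.
- by move=> t [/eqP + /eqP]; rewrite !oppr_eq0 => /eqP xt /eqP yt; apply: (nz t); rewrite xt yt.
- by rewrite x00 y0E oppr0 opprK.
Qed.

Lemma small_orbits_rev f B : small_orbits f B -> small_orbits f (- B).
Proof.
move=> [e e0 orb]; exists e => // y0 y00 y0e.
have [||x [y [T [sol T0 per nz [x00 y0E]]]]] := orb (- y0); rewrite ?oppr_eq0 ?normrN //.
exists (fun t => x (- t)), (fun t => - y (- t)), T; split => //.
- exact: solves_rev.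
- move=> t; have [xp yp] := per (- (t + T)).
  by rewrite -xp -yp opprD subrK.
- move=> t [xt /eqP]; rewrite oppr_eq0 => /eqP yt; apply: (nz (- t)).
  by rewrite xt yt.
- by rewrite /= oppr0 x00 y0E opprK.
Qed.

Lemma comp_poly_exp p q m : (p ^+ m) \Po q = (p \Po q) ^+ m.
Proof. by rewrite -(comp_Xn_poly p) -comp_polyA comp_Xn_poly. Qed.

Lemma comp_poly_opp p q : (- p) \Po q = - (p \Po q).
Proof. by rewrite -sub0r comp_polyB comp_poly0 sub0r. Qed.

Definition normal_data f B u E c k : Prop :=
  [/\ f`_0 = 1, 'X^(n.+1) %| B, odd k, c != 0 :> R & E \Po (- 'X) = E] /\
  [/\ 'X^(n.+1) %| E, u`_0 = 0, u`_1 = 1,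
    eqmodX (2 * n + k) (u^`() * u ^+ (2 * n - 1) * f) 'X^(2 * n - 1) &
    eqmodX k.+1 B (f * (E \Po u + c *: u ^+ k))].

Lemma normal_data_rev f B u E c k :
  normal_data f B u E c k -> normal_data f (- B) u (- E) (- c) k.
Proof.
move=> [[f0 dB ok c0 Ev] [dE u0 u1 eu eB]]; split; split=> //.
- by rewrite dvdpNr.
- by rewrite oppr_eq0.
- by rewrite comp_poly_opp Ev.
- by rewrite dvdpNr.
- rewrite comp_poly_opp scaleNr -opprD mulrN /eqmodX -opprD dvdpNr.
  exact: eB.
Qed.

Lemma eqmodXN k p q : eqmodX k p q -> eqmodX k (- p) (- q).
Proof. by rewrite /eqmodX -opprD dvdpNr. Qed.

Lemma coef_refl p i : (p \Po (- 'X))`_i = (-1) ^+ i * p`_i.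
Proof. by rewrite -scaleN1r coef_comp_scaleX. Qed.

Lemma dvdX_refl p k : 'X^k %| p -> 'X^k %| p \Po (- 'X).
Proof.
move=> /dvdpP [q ->]; rewrite comp_polyM comp_Xn_poly exprNn; apply: dvdp_mull.
by rewrite dvdp_mull.
Qed.

(** The half-turn sends [E + c X^k] to [- E + c X^k], whereas time reversal negates both terms; so
    the signs of [c] and [E'] can be prescribed independently. *)
Lemma normal_data_refl f B u E c k : normal_data f B u E c k ->
  normal_data (f \Po (- 'X)) (- (B \Po (- 'X))) (- (u \Po (- 'X))) (- E) c k.
Proof.
move=> [[f0 dB ok c0 Ev] [dE u0 u1 eu eB]].
have X0 : (- 'X : {poly R})`_0 = 0 by rewrite coefN coefX oppr0.
have odd_n : odd (2 * n - 1) by move: n_gt0; clear; lia.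
have expN (p : {poly R}) m : odd m -> (- p) ^+ m = - p ^+ m.
  by move=> om; rewrite exprNn -signr_odd om expr1 mulN1r.
split; split=> //.
- by rewrite coef_refl expr0 mul1r.
- by rewrite dvdpNr dvdX_refl.
- by rewrite comp_poly_opp Ev.
- by rewrite dvdpNr.
- by rewrite coefN coef_refl u0 mulr0 oppr0.
- by rewrite coefN coef_refl u1 expr1 mulr1 opprK.
- have := eqmodX_compr X0 eu.
  rewrite !comp_polyM comp_Xn_poly comp_poly_exp (expN 'X _ odd_n) => eu'.
  have -> : (- (u \Po - 'X))^`() = u^`() \Po - 'X.
    by rewrite derivN deriv_comp derivN derivX mulrN1 opprK.
  rewrite (expN _ _ odd_n) mulrN mulNr -['X^_]opprK; exact: eqmodXN.
- have := eqmodX_compr X0 eB; rewrite comp_polyM comp_polyD comp_polyZ comp_poly_exp -comp_polyA.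
  have -> : E \Po (u \Po - 'X) = E \Po - (u \Po - 'X).
    by rewrite -{1}Ev -comp_polyA comp_poly_opp comp_polyX.
  have -> : (u \Po - 'X) ^+ k = - (- (u \Po - 'X)) ^+ k by rewrite expN // opprK.
  move/eqmodXN; congr (eqmodX _ _ _).
  by rewrite comp_poly_opp scalerN; ring.
Qed.

(** Near 0 a nonzero polynomial has the sign of its lowest-order term. *)
Lemma horner_sign p : exists2 d : R, 0 < d &
  (forall a, 0 <= a <= d -> 0 <= p.[a]) \/ (forall a, 0 <= a <= d -> p.[a] <= 0).
Proof.
have [m] := ubnP (size p); elim: m p => // m IH p szp.
have [->|pn0] := eqVneq p 0; first by exists 1 => //; left => a _; rewrite horner0.
have [p0|p0] := eqVneq p`_0 0.
  have /factor_theorem [q pq] : root p 0 by rewrite /root horner_coef0 p0.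
  rewrite subr0 in pq; have [|d d0 sgn] := IH q.
    by move: szp; rewrite pq size_mulX ?ltnS //; apply: contraNneq pn0 => q0; rewrite pq q0 mul0r.
  exists d => //; case: sgn => sgn; [left|right] => a /[dup] ad /andP[a0 _]; rewrite pq hornerMX.
    by rewrite mulr_ge0 ?sgn.
  by rewrite mulr_le0_ge0 ?sgn.
have [|d /andP[d0 _] near1] := @horner_near1 R ((p`_0)^-1 *: p); first by rewrite coefZ mulVf.
exists d => //; have [pos|neg|/eqP] := ltgtP p`_0 0; last by rewrite (negPf p0).
  right=> a /andP[a0 ad]; have := near1 a; rewrite ger0_norm // hornerZ => /(_ ad)/andP[l _].
  have : 0 < (p`_0)^-1 * p.[a] by apply: lt_le_trans l.
  by rewrite nmulr_rgt0 ?invr_lt0 // => /ltW.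
left=> a /andP[a0 ad]; have := near1 a; rewrite ger0_norm // hornerZ => /(_ ad)/andP[l _].
have : 0 < (p`_0)^-1 * p.[a] by apply: lt_le_trans l.
by rewrite pmulr_rgt0 ?invr_gt0 // => /ltW.
Qed.

(* Starting from the crossing of the negative [y]-axis closest to the origin, the orbit next returns
   at or below it: this replaces the uniqueness of solutions and the Jordan curve theorem. *)
Lemma maximal_crossing x y T : continuous x -> continuous y -> 0 <= T ->
  (forall t, x (t + T) = x t /\ y (t + T) = y t) -> x 0 = 0 -> y 0 <= 0 ->
  exists t0, [/\ 0 <= t0 <= T, x t0 = 0, y 0 <= y t0, y t0 <= 0 &
    forall t, 0 <= t <= 3 * T -> x t = 0 -> y t <= 0 -> y t <= y t0].
Proof.
move=> xc yc T0 per x0 y0.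
pose A : set R := `[0, T] `&` ([set t | x t = 0] `&` [set t | y t <= 0]).
have cA : compact A.
  apply: compact_closedI; first exact: segment_compact.
  apply: closedI.
    by apply: (@closed_comp _ _ x [set u | u = 0]) => [t _|]; [exact: xc|exact: closed_eq].
  by apply: (@closed_comp _ _ y [set u | u <= 0]) => [t _|]; [exact: yc|exact: closed_le].
have A0 : A 0 by split => //=; rewrite in_itv /= lexx.
have [|t0] := @compact_EVT_max R R y A (ex_intro _ 0 A0) cA.
  exact: continuous_subspaceT.
move=> /set_mem [/=]; rewrite in_itv /= => t0T [xt0 yt0] max.
have base t : 0 <= t <= T -> x t = 0 -> y t <= 0 -> y t <= y t0.
  by move=> tT xt yt; apply: max; apply/mem_set; split => //=; rewrite in_itv.
exists t0; split=> //; first by apply: base => //; rewrite lexx.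
(* Periodicity extends the bound to [3 * T]: from [t0 <= T] two excursions follow, each lasting at
   most [T]. *)
have step s (t : R) : (forall t, 0 <= t <= s -> x t = 0 -> y t <= 0 -> y t <= y t0) ->
    0 <= s -> 0 <= t <= s + T -> x t = 0 -> y t <= 0 -> y t <= y t0.
  move=> IH s0 /andP[t_0 tsT] xt yt; have [ts|st] := leP t s; first by apply: IH => //; rewrite t_0.
  have [tT|Tt] := leP t T; first by apply: base => //; rewrite t_0.
  have [xp yp] := per (t - T); rewrite subrK in xp yp.
  rewrite yp; apply: IH; rewrite -?xp -?yp //; apply/andP; split; lra.
have base2 : forall t, 0 <= t <= T + T -> x t = 0 -> y t <= 0 -> y t <= y t0.
  by move=> t; apply: step.
move=> t tT; apply: (step (T + T)) => //; first by rewrite addr_ge0.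
by have -> : T + T + T = 3 * T by ring.
Qed.

(** [c < 0] makes the slope of [z] over [y] less than [2n (E - y)] on the right half. It does the
    same for the half-turned left half, whose slope, turned back, is therefore greater: the
    situation refuted by the comparison. *)
Lemma no_center_monotone f B u E c k (eE : R) : normal_data f B u E c k -> c < 0 ->
  0 < eE -> (forall a, 0 <= a <= eE -> 0 <= E^`().[a]) -> ~ small_orbits f B.
Proof.
move=> data c0 eE0 E'pos [eps eps0 orb].
have [[f0 dB ok cn0 Ev] [dE u0 u1 eu eB]] := data.
have [[f0' dB' _ _ _] [_ u0' u1' eu' eB']] := normal_data_refl data.
have dE' : 'X^n %| E^`().
  rewrite -[E^`()]subr0 -(deriv0 R); apply: eqmodX_deriv.
  by rewrite /eqmodX subr0.
have [C C0 E'b] := horner_bigO dE'.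
pose e1 := Num.min eE 1.
have e10 : 0 < e1 by rewrite lt_min eE0 ltr01.
have e1E : e1 <= eE by rewrite ge_min lexx.
have e11 : e1 <= 1 by rewrite ge_min lexx orbT.
have Ehom r s : 0 <= r -> r <= s -> s <= e1 -> E.[r] <= E.[s].
  move=> r0 rs s1; rewrite -lerN2.
  apply: (@nonincreasing_derive R (fun t => - E.[t]) (fun t => - E^`().[t]) r s rs).
  - exact: (@derive_within_continuous _ _ (fun t => - E^`().[t])).
  - move=> t /andP[rt ts]; rewrite oppr_le0 E'pos // (le_trans r0 (ltW rt)) /=.
    by rewrite (le_trans (ltW ts)) // (le_trans s1).
have Elip r s : 0 <= r -> r <= s -> s <= e1 -> E.[s] - E.[r] <= C * (s ^+ n - r ^+ n).
  move=> r0 rs s1; suff : E.[s] - C * s ^+ n <= E.[r] - C * r ^+ n by lra.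
  pose dpsi (t : R) := E^`().[t] - (0 * t ^+ n + C * (n%:R * t ^+ n.-1 * 1)).
  have psid (t : R) : is_derive t 1 (fun t => E.[t] - C * t ^+ n) (dpsi t).
    by apply: der_sub (is_derive_poly _ _) (der_mul (der_cst _ _) (der_exp_fun n (der_id t))).
  apply: (@nonincreasing_derive R (fun t => E.[t] - C * t ^+ n) dpsi r s rs).
  - by apply: (@derive_within_continuous _ _ dpsi) => t _; exact: psid.
  move=> t /andP[rt ts]; have t0 : 0 <= t by exact: le_trans (ltW rt).
  have t1 : t <= 1 by rewrite (le_trans (ltW ts)) // (le_trans s1).
  have tn0 : 0 <= t ^+ n.-1 by rewrite exprn_ge0.
  rewrite /dpsi mul0r add0r mulr1 subr_le0; apply: le_trans (ler_norm _) _.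
  have := E'b t; rewrite ger0_norm // => /(_ t1)/le_trans; apply.
  rewrite ler_wpM2l // -{1}(prednK n_gt0) exprS ler_wpM2r //.
  by rewrite (le_trans t1) // ler1n.
have [d1 d10 half1] := half_return n_gt0 f0 u0 u1 eu eB c0 e10.
have [d2 d20 half2] := half_return n_gt0 f0' u0' u1' eu' eB' c0 e10.
have [eta1 eta10 conf1] := confinement n_gt0 f0 dB d10.
have [eta2 eta20 conf2] := confinement n_gt0 f0' dB' d20.
pose K : R := (2 * n + 1)%:R.
have K0 : 0 < K by rewrite ltr0n addn1.
have K1 : 1 <= K by rewrite ler1n addn1.
(* [eps] provides the orbit and [eta1] confines its right half, on which [|y| <= K * m]. The left
   half thus starts below [eta2], and [K * K * m < 1] keeps [|y| <= 1] throughout. *)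
pose m := Num.min (Num.min eps eta1) (Num.min (eta2 / K) (K * K)^-1) / 2.
have eta2K : 0 < eta2 / K by rewrite divr_gt0.
have KK0 : 0 < (K * K)^-1 by rewrite invr_gt0 mulr_gt0.
have m0 : 0 < m by rewrite divr_gt0 // !lt_min eps0 eta10 eta2K KK0.
have mlt z : Num.min (Num.min eps eta1) (Num.min (eta2 / K) (K * K)^-1) <= z -> m < z.
  by move=> mz; apply: lt_le_trans mz; rewrite /m in m0 *; lra.
have m_eps : m < eps by apply: mlt; rewrite !ge_min lexx.
have m_eta1 : m < eta1 by apply: mlt; rewrite !ge_min lexx !orbT.
have m_eta2 : K * m < eta2 by rewrite mulrC -ltr_pdivlMr //; apply: mlt; rewrite !ge_min lexx !orbT.
have m_1 : K * (K * m) < 1.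
  by rewrite mulrA mulrC -ltr_pdivlMr ?mulr_gt0 // div1r; apply: mlt; rewrite !ge_min lexx !orbT.
have [||x [y [T [sol T0 per nz [x0 y0]]]]] := orb (- m).
- by rewrite oppr_eq0 gt_eqF.
- by rewrite normrN gtr0_norm.
have [xc yc] := solves_continuous sol.
have [|t0 [/andP[t00 t0T] xt0 yt0 yt0' max]] := maximal_crossing xc yc (ltW T0) per x0.
  by rewrite y0 oppr_le0 ltW.
have {}yt0' : y t0 < 0.
  by rewrite lt_neqAle yt0' andbT; apply/eqP => yz; apply: (nz t0); rewrite xt0 yz.
have yt0m : - y t0 <= m by rewrite lerNl -y0.
have B00 (p : {poly R}) : 'X^(n.+1) %| p -> p`_0 = 0.
  by move=> /dvdpP [q ->]; rewrite coefMXn.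
have [t1 [/andP[t01 t1T] xt1 yt1 pos1]] :=
  excursion f0 (B00 _ dB) sol T0 (fun t => (per t).1) nz xt0 yt0'.
have bnd1 t : t0 <= t <= t1 -> x t < d1 /\ `|y t| <= K * - y t0.
  apply: conf1 => //; first by rewrite yt0' andbT ltrNl (le_lt_trans yt0m).
  by move=> s /pos1 /ltW.
have yt1K : y t1 <= K * m.
  have [_ yb] := bnd1 t1 (introT andP (conj (ltW t01) (lexx t1))).
  by apply: le_trans (ler_norm _) (le_trans yb _); rewrite ler_pM2l.
have sol' := solves_refl n_gt0 sol.
have nz' t : (- x t, - y t) <> (0, 0).
  by move=> [/eqP + /eqP]; rewrite !oppr_eq0 => /eqP xt /eqP yt; apply: (nz t); rewrite xt yt.
have xt1' : - x t1 = 0 by rewrite xt1 oppr0.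
have yt1' : - y t1 < 0 by rewrite oppr_lt0.
have [t2 [/andP[t12 t2T] xt2 yt2 pos2]] :=
  excursion f0' (B00 _ dB') sol' T0 (fun t => congr1 -%R (per t).1) nz' xt1' yt1'.
have bnd2 t : t1 <= t <= t2 -> - x t < d2 /\ `|- y t| <= K * - - y t1.
  apply: (conf2 _ _ _ _ sol') => //; first by rewrite yt1' andbT ltrN2 (le_lt_trans yt1K).
  by move=> s /pos2 /ltW.
have [|yab [r1 [dr1 [r1c r1a r1b r1v]]]] := half1 x y t0 t1 sol t01 xt0 xt1.
  move=> t t01t; have /andP[lt0 lt1] := t01t.
  have [xd yd] := bnd1 t (introT andP (conj (ltW lt0) (ltW lt1))).
  rewrite pos1 // xd; split=> //; apply: le_trans yd _; apply: ltW; apply: le_lt_trans m_1.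
  apply: le_trans (ler_wpM2l (ltW K0) yt0m) _.
  by rewrite ler_peMl // mulr_ge0 // ltW.
have [|_ [r2 [dr2 [r2c r2a r2b r2v]]]] := half2 _ _ t1 t2 sol' t12 xt1' xt2.
  move=> t t12t; have /andP[lt1 lt2] := t12t.
  have [xd yd] := bnd2 t (introT andP (conj (ltW lt1) (ltW lt2))).
  rewrite pos2 // xd; split=> //; apply: le_trans yd _; apply: ltW; apply: le_lt_trans m_1.
  by rewrite opprK ler_pM2l.
have yt2m : y t2 <= y t0.
  apply: max.
  - by apply/andP; split; lra.
  - by apply/eqP; rewrite -oppr_eq0; apply/eqP.
  - by rewrite -oppr_ge0 ltW.
(* As [y t2 <= y t0], the left half is defined over the whole [y]-range of the right half. *)
have neg v : y t0 < v < y t1 -> - y t1 < - v < - y t2.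
  by move=> /andP[v0 v1]; rewrite !ltrN2 v1 (le_lt_trans yt2m).
apply: (@comparison_contradiction R n (2 * n)%:R C e1 (y t0) (y t1) (fun a => E.[a]) r1
  (fun v => r2 (- v)) dr1 (fun v => dr2 (- v) * - 1)) => //.
- by rewrite ltr0n muln_gt0.
- by rewrite horner_coef0; apply: B00.
- apply: within_continuous_opp; apply: continuous_subspaceW r2c.
  by apply: subset_itvl; rewrite bnd_simp lerN2.
- by move=> v /r1v[].
- by move=> v /neg/r2v[].
- by move=> v /r1v[].
- move=> v /neg/r2v[_ rd _].
  by apply: (@der_comp _ (fun w => r2 w ^+ (2 * n)) (fun w => - w)) => //; exact: der_opp (der_id _).
- by move=> v /r1v[].
- move=> v /neg/r2v[_ _]; rewrite hornerN opprK mulrN1 ltrNr -mulrN.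
  by have -> : - (E.[r2 (- v)] - v) = - E.[r2 (- v)] + v by ring.
Qed.

(** Near 0 the derivative [E'] keeps one sign; the four combinations with the sign of [c] reduce by
    the symmetries to [c < 0] and [E' >= 0]. *)
Theorem no_center f B u E c k : normal_data f B u E c k -> ~ small_orbits f B.
Proof.
move=> data orb; have [[_ _ _ c0 _] _] := data.
have [d d0 sgn] := horner_sign E^`().
have negE : (forall a, 0 <= a <= d -> E^`().[a] <= 0) ->
    forall a, 0 <= a <= d -> 0 <= (- E)^`().[a].
  by move=> sE a /sE; rewrite derivN hornerN oppr_ge0.
have [cneg|cpos|/eqP] := ltgtP c 0; last by rewrite (negPf c0).
  case: sgn => [sE|/negE sE]; first exact: (no_center_monotone data cneg d0 sE).
  exact: (no_center_monotone (normal_data_refl data) cneg d0 sE) (small_orbits_refl orb).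
have cneg : - c < 0 by rewrite oppr_lt0.
have data' := normal_data_rev data; have orb' := small_orbits_rev orb.
case: sgn => [|/negE] sE; last exact: (no_center_monotone data' cneg d0 sE orb').
apply: (no_center_monotone (normal_data_refl data') cneg d0 _ (small_orbits_refl orb')).
by rewrite opprK.
Qed.

End NoCenter.

Theorem proposition9 (R : realType) (n : nat) (a : nat -> nat -> R)
  (hn : (3 <= n)%N) (hodd : odd n)
  (hcenter : origin_is_center
    (fun x y : R => - y + y * (\sum_(1 <= k < n) a k 1%N * x ^+ k)
                    + \sum_(n.+1 <= k < 2 * n) a k 0%N * x ^+ k)
    (fun x y : R => x ^+ (2 * n - 1))) :
  a (n + 2)%N 0%N = - a 1%N 1%N * a (n + 1)%N 0%N.
Proof.
pose f : {poly R} := \poly_(i < n) (if i == 0%N then 1 else - a i 1%N).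
pose b : {poly R} := \poly_(i < n.-1) a (i + n.+1)%N 0%N.
have n1 : (1 < n)%N by exact: leq_trans hn.
have f0 : f`_0 = 1 by rewrite coef_poly (ltnW n1).
have f1 : f`_1 = - a 1%N 1%N by rewrite coef_poly n1.
have b0 : b`_0 = a (n + 1)%N 0%N.
  by rewrite coef_poly add0n addn1 -subn1 subn_gt0 n1.
have b1 : b`_1 = a (n + 2)%N 0%N.
  by rewrite coef_poly -subn1 ltn_subRL hn add1n addn2.
have fE (x : R) : f.[x] = 1 - \sum_(1 <= k < n) a k 1%N * x ^+ k.
  rewrite horner_poly -(big_mkord xpredT (fun i => (if i == 0%N then 1 else - a i 1%N) * x ^+ i)).
  rewrite big_ltn ?(ltnW n1) //= expr0 mulr1 -sumrN; congr (_ + _).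
  by apply: eq_big_nat => -[//|i] _; rewrite mulNr.
have BE (x : R) : (b * 'X^(n.+1)).[x] = \sum_(n.+1 <= k < 2 * n) a k 0%N * x ^+ k.
  rewrite hornerM hornerXn horner_poly -[n.+1 in RHS]add0n big_addn.
  have -> : (2 * n - n.+1 = n.-1)%N by lia.
  by rewrite big_mkord mulr_suml; apply: eq_bigr => i _; rewrite exprD mulrA.
have orbits : small_orbits n f (b * 'X^(n.+1)).
  have [U /nbhs_ballP [e /= e0 eU] orb] := hcenter.
  exists e => // y0 y00 y0e.
  have [||x [y [sol [x0 yE] [[T T0 per] _] [nz _]]]] := orb (0, y0).
  - by apply: eU; split; rewrite /ball /= ?subrr ?normr0 // sub0r normrN.
  - by case=> /eqP; exact/negP.
  exists x, y, T; split=> //.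
    move=> t; have [xd yd] := sol t; split; last exact: yd.
    by apply: is_derive_eq xd _; rewrite fE BE; ring.
  by move=> t xy0; apply: nz; exists t.
have [xi [xi0 xi1 ode]] := @normalizing_series R (2 * n - 1) f f0.
have [inv|ninv] := pselect (evp (@fps_const R) b xi * xi ^+ n.+1 * evp (@fps_const R) f (fps_refl xi) =
    evp (@fps_const R) b (fps_refl xi) * fps_refl xi ^+ n.+1 * evp (@fps_const R) f xi).
  (* Both sides of the claim vanish: [b_1 = 0], and one of [b_0] and [f_1] is 0. *)
  have [b10] := even_quotient hn hodd f0 (size_poly _ _) (size_poly _ _) xi0 xi1 ode inv.
  rewrite -b1 -f1 -b0 b10; case=> ->; first by rewrite mulr0.
  by rewrite mul0r.
move/eqP: ninv => /(normal_form hn f0 xi0 xi1 ode) [u [E [c [k [[ok c0 Ev dE] [u0 u1 eu eB]]]]]].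
have n_gt0 : (0 < n)%N by exact: ltnW n1.
exfalso; apply: (@no_center R n n_gt0 f (b * 'X^(n.+1)) u E c k) => //.
by split; split=> //; exact: dvdp_mulIr.
Qed.
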